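(* Let $T$ be an interface element (an arbitrary triangle if $N=2$ or tetrahedron if $N=3$), and let $\mathbb B^+,\mathbb B^-\in\mathbb R^{N\times N}$ be constant matrices for which there are constants $b_M^\pm\ge b_m^\pm>0$ with $b_m^\pm\le\mathbf y^T\mathbb B^\pm\mathbf y\le b_M^\pm$ for all $\mathbf y\in\mathbb R^N$ with $\mathbf y^T\mathbf y=1$. Let $$S_h(T)=\{\phi\in L^2(T):\ \phi|_{T_h^\pm}\in\mathbb P_1(T_h^\pm),\ [\phi]_{\Gamma_{h,T}}=0,\ [\mathbb B_T\nabla\phi\cdot\mathbf n_h]_{\Gamma_{h,T}}=0\},\qquad \mathbb B_T|_{T_h^\pm}=\mathbb B^\pm.$$ Then the IFE basis functions are unisolvent on $T$: for each $i=1,\dots,N+1$ there exists a unique $\phi_{i,T}\in S_h(T)$ with $\mathcal N_{j,T}(\phi_{i,T})=\delta_{ij}$ for all $j=1,\dots,N+1$.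
   Context: $N\in\{2,3\}$. An interface element $T$ is an open simplex in $\mathbb R^N$ (an element of a triangulation not fitted to the interface) that is cut by the discrete interface: $\Gamma_{h,T}=T\cap\Gamma_{h,T}^{ext}\neq\emptyset$, where $\Gamma_{h,T}^{ext}$ is a hyperplane of dimension $N-1$, splitting $T$ into two nonempty open parts $T_h^+$ and $T_h^-$. $\mathbf n_h$ is the constant unit vector perpendicular to $\Gamma_{h,T}$ pointing from $T_h^-$ to $T_h^+$. $[v]_{\Gamma_{h,T}}$ is the jump across $\Gamma_{h,T}$ (value from $T_h^+$ minus value from $T_h^-$). $\mathbb P_1(D)$ is the set of polynomials of degree $\le1$ on $D$. $F_1,\dots,F_{N+1}$ are the faces of $T$ (edges if $N=2$) and $\mathcal N_{i,T}(v)=\frac1{|F_i|}\int_{F_i}v$, with $|F_i|$ the measure of $F_i$. *)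

(* Defs.v *)
From HB Require Import structures.
From mathcomp Require Import all_boot all_order all_algebra.
From mathcomp Require Import all_classical all_reals all_analysis.

Set Implicit Arguments.
Unset Strict Implicit.
Unset Printing Implicit Defensive.

Import Order.TTheory GRing.Theory Num.Theory.
Import numFieldNormedType.Exports.

Local Open Scope classical_set_scope.
Local Open Scope ring_scope.

(* Lebesgue measure on R^n is not in the library; it is built here on
   [n.-tuple R] (product sigma-algebra) by iterating the binary product. *)
Section lebesgue_tuple.
Context {R : realType}.

Definition tuple_cons n (z : R * n.-tuple R) : n.+1.-tuple R :=
  [tuple of z.1 :: z.2].

Lemma measurable_tuple_cons n : measurable_fun [set: R * n.-tuple R] (@tuple_cons n).
Proof. exact: measurable_cons. Qed.

Section step.
Context n (mu : {sigma_finite_measure set (n.-tuple R) -> \bar R}).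

Definition lebesgue_cons : set (n.+1.-tuple R) -> \bar R :=
  pushforward (@lebesgue_measure R \x mu)%E (@tuple_cons n).

Let lebesgue_cons0 : lebesgue_cons set0 = 0%E.
Proof. by rewrite /lebesgue_cons /pushforward preimage_set0 measure0. Qed.

Let lebesgue_cons_ge0 A : (0 <= lebesgue_cons A)%E.
Proof. exact: (measure_ge0 (@lebesgue_measure R \x mu)%E). Qed.

Let lebesgue_cons_sigma_additive : semi_sigma_additive lebesgue_cons.
Proof.
move=> F mF tF mUF; rewrite /lebesgue_cons /pushforward preimage_bigcup.
have mpre A : measurable A -> measurable (@tuple_cons n @^-1` A).
  by move=> mA; rewrite -[X in measurable X]setTI; exact: measurable_tuple_cons.
apply: measure_semi_sigma_additive.
- by move=> k; exact: mpre.
- apply/trivIsetP => /= i j _ _ ij; rewrite -preimage_setI.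
  by move/trivIsetP : tF => /(_ _ _ _ _ ij) ->//; rewrite preimage_set0.
- by rewrite -preimage_bigcup; exact: mpre.
Qed.

HB.instance Definition _ := isMeasure.Build _ _ _ lebesgue_cons
  lebesgue_cons0 lebesgue_cons_ge0 lebesgue_cons_sigma_additive.

Let lebesgue_cons_sigma_finite : sigma_finite setT lebesgue_cons.
Proof.
have /sigma_finiteP[F [TF ndF Foo]] := sigma_finiteT (@lebesgue_measure R).
have /sigma_finiteP[G [TG ndG Goo]] := sigma_finiteT mu.
pose u (t : n.+1.-tuple R) : R * n.-tuple R := (thead t, [tuple of behead t]).
have uK : cancel (@tuple_cons n) u.
  by move=> [x t]; rewrite /u theadE; congr pair; apply/val_inj.
have mu_ : measurable_fun [set: n.+1.-tuple R] u.
  apply/measurable_fun_pairP; split; first exact: measurable_tnth.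
  exact: measurable_behead.
exists (fun k => u @^-1` (F k `*` G k)).
  apply/seteqP; split=> // t _.
  have [i _ Fi] : (\bigcup_i F i) (u t).1 by rewrite -TF.
  have [j _ Gj] : (\bigcup_i G i) (u t).2 by rewrite -TG.
  exists (maxn i j) => //; split.
    by move: Fi; exact/subsetPset/ndF/leq_maxl.
  by move: Gj; exact/subsetPset/ndG/leq_maxr.
move=> k; have [mF Fk] := Foo k; have [mG Gk] := Goo k; split.
  by rewrite -[X in measurable X]setTI; apply: mu_ => //; exact: measurableX.
rewrite /lebesgue_cons /pushforward -comp_preimage.
rewrite (_ : u \o _ = idfun); last by apply/funext => z; exact: uK.
rewrite preimage_id product_measure1E// lte_mul_pinfty//.
by rewrite ge0_fin_numE.
Qed.

HB.instance Definition _ := Measure_isSigmaFinite.Build _ _ _ lebesgue_cons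
  lebesgue_cons_sigma_finite.

End step.

Fixpoint lebesgue_tuple n : {sigma_finite_measure set (n.-tuple R) -> \bar R} :=
  if n is n'.+1 then lebesgue_cons (lebesgue_tuple n') else \d_ [tuple].

End lebesgue_tuple.
Arguments lebesgue_tuple : clear implicits.

Lemma lebesgue_tuple_box (R : realType) n (A : 'I_n -> set R) :
  (forall i, measurable (A i)) ->
  lebesgue_tuple R n [set t | forall i, A i (tnth t i)] =
  (\prod_i lebesgue_measure (A i))%E.
Proof.
elim: n A => [|n IH] A mA.
  rewrite big_ord0 /= diracE mem_set//= => -[] //.
rewrite big_ord_recl -IH// /= /lebesgue_cons /pushforward.
rewrite -product_measure1E//.
  congr (_ _); apply/seteqP; split => -[x t] /= H.
    by split; [exact: (H ord0)|move=> i; have := H (lift ord0 i); rewrite tnthS].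
  by move=> i; case: (unliftP ord0 i) => [j ->|->]; [rewrite tnthS; apply H.2|exact: H.1].
  exact: mA.
rewrite [X in measurable X](_ : _ =
  \bigcap_(i in [set: 'I_n]) (@tnth n R ^~ i) @^-1` A (lift ord0 i)).
  by apply: fin_bigcap_measurable => // i _; rewrite -[X in measurable X]setTI;
     exact: measurable_tnth.
by apply/seteqP; split => t /= H i => [_|]; exact: H.
Qed.

Section ife_space.
Context {R : realType} (n : nat).

(* The ambient dimension is N := n.+1; points and vectors are columns. *)
Local Notation N := n.+1.
Local Notation vec := 'cV[R]_N.

Definition dot (u v : vec) : R := (u^T *m v) 0 0.

Definition grad (f : vec -> R) (x : vec) : vec :=
  \col_i 'D_(delta_mx i 0) f x.

Definition affinely_independent m (p : 'I_m -> vec) : Prop :=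
  forall l : 'I_m -> R, \sum_i l i = 0 -> \sum_i l i *: p i = 0 ->
  forall i, l i = 0.

Definition open_simplex (p : 'I_N.+1 -> vec) : set vec :=
  [set x | exists l : 'I_N.+1 -> R,
    [/\ forall i, 0 < l i, \sum_i l i = 1 & x = \sum_i l i *: p i]].

Definition P1_on (D : set vec) (f : vec -> R) : Prop :=
  exists (a : vec) (b : R), forall x, D x -> f x = dot a x + b.

Definition point_of_tuple (t : N.-tuple R) : vec := \col_i tnth t i.

Definition L2_on (D : set vec) (f : vec -> R) : Prop :=
  (f \_ D) \o point_of_tuple \in Lfun (lebesgue_tuple R N) 2%:E.

Definition ae_eq_on (D : set vec) (f g : vec -> R) : Prop :=
  \forall t \ae lebesgue_tuple R N,
    D (point_of_tuple t) -> f (point_of_tuple t) = g (point_of_tuple t).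

(* The element with vertices [p], cut by the hyperplane [dot nh x = c] with
   unit normal [nh]. *)
Section element.
Variables (p : 'I_N.+1 -> vec) (nh : vec) (c : R).

Definition elem : set vec := open_simplex p.
Definition interface : set vec := elem `&` [set x | dot nh x = c].
Definition elem_pos : set vec := elem `&` [set x | c < dot nh x].
Definition elem_neg : set vec := elem `&` [set x | dot nh x < c].

Definition jump (v : vec -> R) (x : vec) : R :=
  lim (v y @[y --> within elem_pos (nbhs x)]) -
  lim (v y @[y --> within elem_neg (nbhs x)]).

(* Boundary values as limits from inside the element. The interface, a null
   set, is left out of the limit, so that only the class of [v] in L^2
   matters for [v] continuous on either side. *)
Definition trace (v : vec -> R) (x : vec) : R :=
  lim (v y @[y --> within (elem_pos `|` elem_neg) (nbhs x)]).

(* Face opposite to the vertex [p i]. *)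
Definition face (i : 'I_N.+1) : set vec :=
  [set x | exists l : 'I_N.+1 -> R,
    [/\ forall k, 0 <= l k, l i = 0, \sum_k l k = 1 & x = \sum_k l k *: p k]].

(* Surface integrals over [face i] are computed in the chart [face_chart i],
   defined on the reference simplex of R^n (see [face_chart_image]), with
   surface element the square root of the Gram determinant of the edges. *)
Definition face_origin (i : 'I_N.+1) : vec := p (lift i ord0).

Definition face_edges (i : 'I_N.+1) : 'M[R]_(N, n) :=
  \matrix_(r, k) (p (lift i (lift ord0 k)) - face_origin i) r 0.

Definition face_chart (i : 'I_N.+1) (t : n.-tuple R) : vec :=
  face_origin i + face_edges i *m \col_k tnth t k.

Definition face_density (i : 'I_N.+1) : R :=
  Num.sqrt (\det ((face_edges i)^T *m face_edges i)).

Definition ref_simplex : set (n.-tuple R) :=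
  [set t | (forall k, 0 <= tnth t k) /\ \sum_k tnth t k <= 1].

Lemma face_chart_image (i : 'I_N.+1) : face_chart i @` ref_simplex = face i.
Proof.
apply/seteqP; split => [_ [t [t0 t1] <-]|x [l [l0 li l1 ->]]].
  pose l k := if unlift i k is Some k1 then
    if unlift ord0 k1 is Some k2 then tnth t k2 else 1 - \sum_k tnth t k
    else 0.
  have lE k : l (lift i (lift ord0 k)) = tnth t k by rewrite /l !liftK.
  have lE0 : l (lift i ord0) = 1 - \sum_k tnth t k.
    by rewrite /l liftK unlift_none.
  have lEi : l i = 0 by rewrite /l unlift_none.
  exists l; split => //.
  - move=> k; rewrite /l; case: unliftP => // k1 _.
    by case: unliftP => // _; rewrite subr_ge0.
  - rewrite (bigD1_ord i)//= big_ord_recl lEi lE0 add0r.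
    by under [X in _ + X]eq_bigr do rewrite lE; rewrite subrK.
  - rewrite (bigD1_ord i)//= big_ord_recl lEi lE0 scale0r add0r.
    under [X in _ = _ + X]eq_bigr do rewrite lE.
    apply/colP => r; rewrite /face_chart !mxE summxE.
    rewrite mulrBl mul1r -addrA; congr +%R.
    rewrite mulr_suml addrC -sumrB; apply: eq_bigr => k _.
    by rewrite !mxE mulrBl; congr (_ - _); rewrite mulrC.
pose t : n.-tuple R := [tuple l (lift i (lift ord0 k)) | k < n].
have tE k : tnth t k = l (lift i (lift ord0 k)) by rewrite tnth_mktuple.
have sumt : \sum_k tnth t k = 1 - l (lift i ord0).
  rewrite -l1 (bigD1_ord i)//= big_ord_recl li add0r [RHS]addrAC subrr add0r.
  by apply: eq_bigr => k _.
exists t.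
  by split => [k|]; rewrite ?tE// sumt lerBlDr lerDl.
rewrite (bigD1_ord i)//= big_ord_recl li scale0r add0r.
apply/colP => r; rewrite /face_chart !mxE summxE.
have -> : l (lift i ord0) = 1 - \sum_k tnth t k by rewrite sumt subKr.
rewrite mulrBl mul1r -addrA; congr +%R.
rewrite mulr_suml addrC -sumrB; apply: eq_bigr => k _.
by rewrite !mxE tE mulrBl mulrC; congr (_ - _); rewrite mulrC.
Qed.

Definition face_integral (i : 'I_N.+1) (v : vec -> R) : R :=
  \int[lebesgue_tuple R n]_(t in ref_simplex)
    (v (face_chart i t) * face_density i).

Definition face_mean (i : 'I_N.+1) (v : vec -> R) : R :=
  face_integral i (trace v) / face_integral i (cst 1).

Definition piecewise_mx (Bp Bm : 'M[R]_N) (x : vec) : 'M[R]_N :=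
  if x \in elem_pos then Bp else Bm.

(* S_h(T), as a set of representatives: an element is determined by its
   restrictions to the two pieces, its values on the interface are irrelevant
   and equality is [ae_eq_on elem]. *)
Definition ife_space (Bp Bm : 'M[R]_N) : set (vec -> R) :=
  [set phi |
    [/\ L2_on elem phi,
        P1_on elem_pos phi,
        P1_on elem_neg phi,
        forall x, interface x -> jump phi x = 0 &
        forall x, interface x ->
          jump (fun y => dot (piecewise_mx Bp Bm y *m grad phi y) nh) x = 0]].

End element.
End ife_space.

Arguments elem {R n}.

(* Main.v *)
Require Import Defs.
From mathcomp Require Import all_boot all_order all_algebra fingroup perm.
From mathcomp Require Import all_classical all_reals all_analysis.
From mathcomp Require Import measurable_realfun ring lra.

(** Why the basis functions are unisolvent. Continuity across the interface
    makes an element of the space, off the interface, a function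
      u . x + b + al (nh . x - c)^+
    (lemma [ife_spaceP]), and the flux condition becomes one linear equation
    relating al to u. The mean values on the faces of an affine function
    determine it ([nodal_valuesP], [affine_eq0]), and those of the kink
    (nh . x - c)^+ are the mean values of an affine function whose gradient is
    theta nh with 0 <= theta <= 1 ([face_mean_interpolant]). Prescribing the mean
    values of the piecewise function thus prescribes w = u + al theta nh, and in
    terms of w the flux condition reads
      al ((1 - theta) nh . Bp nh + theta nh . Bm nh) = nh . (Bm - Bp) w.
    Coercivity makes the coefficient of al positive, so that al, then u and b, are
    determined. For general matrices this depends on the gradient of the
    interpolated kink having exactly the direction of nh.

    That fact follows from the divergence theorem, but a direct argument
    avoids it. The integral of the kink over a face depends only on the values
    d k = nh . p k - c at the vertices of the face and is symmetric in them
    ([pos_integral_perm]); it is a divided difference, and it satisfies the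
    recurrence [pos_integral_triple], obtained by integrating along one
    coordinate. Hence the integrals over the faces opposite to the vertices are an
    affine function of the values d j, and monotonicity and the Lipschitz bound of
    the positive part confine its slope
    ([pos_integral_face_affine]).

    The remaining work relates the definitions to this computation: traces and
    jumps are limits along nonempty filters at the points of the closed element
    ([proper_elem_pos], [trace_eq], [jump_eq]), the surface element of a face is
    positive ([face_density_gt0]), and hyperplanes are null sets
    ([lebesgue_tuple_hyperplane]). *)

Set Implicit Arguments.
Unset Strict Implicit.
Unset Printing Implicit Defensive.

Import Order.TTheory GRing.Theory Num.Theory.
Import numFieldNormedType.Exports.
Local Open Scope classical_set_scope.
Local Open Scope ring_scope.

(** * Permuting and integrating out coordinates *)

Section tuple_measure.
Context {R : realType}.
Local Notation mu := (lebesgue_tuple R).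

Definition box n (A : 'I_n -> set R) : set (n.-tuple R) :=
  [set t | forall i, A i (tnth t i)].

Lemma measurable_box n (A : 'I_n -> set R) :
  (forall i, measurable (A i)) -> measurable (box A).
Proof.
move=> mA; rewrite (_ : box A = \bigcap_(i in [set: 'I_n]) (@tnth n R ^~ i) @^-1` A i).
  apply: fin_bigcap_measurable => // i _.
  by rewrite -[X in measurable X]setTI; exact: measurable_tnth.
by apply/seteqP; split => t /= H i => [_|]; exact: H.
Qed.

Lemma measurable_boxE n : @measurable _ (n.-tuple R) =
  <<s [set B | exists2 A : 'I_n -> set R, (forall i, measurable (A i)) & B = box A] >>.
Proof.
apply/seteqP; split.
  apply: smallest_sub; first exact: smallest_sigma_algebra.
  rewrite -bigcup_seq => _ [i /= _ [B mB <-]].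
  apply: sub_sigma_algebra => /=.
  exists (fun j => if j == i then B else setT).
    by move=> j; case: ifP.
  apply/seteqP; split => t /=.
    by move=> [_ Bt] j; case: ifP => // /eqP ->.
  by move=> /(_ i); rewrite eqxx.
apply: smallest_sub; first exact: sigma_algebra_measurable.
by move=> _ [A mA ->]; exact: measurable_box.
Qed.

Definition tuple_perm n (s : {perm 'I_n}) (t : n.-tuple R) : n.-tuple R :=
  [tuple tnth t (s i) | i < n].

Lemma measurable_tuple_perm n (s : {perm 'I_n}) :
  measurable_fun [set: n.-tuple R] (tuple_perm s).
Proof.
apply/measurable_fun_tnthP => i.
rewrite (_ : _ \o _ = @tnth n R ^~ (s i)); first exact: measurable_tnth.
by apply/funext => t /=; rewrite tnth_mktuple.
Qed.


Lemma tnth_tuple_cons0 n (z : R * n.-tuple R) : tnth (tuple_cons z) ord0 = z.1.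
Proof. exact: tnth0. Qed.

Lemma tnth_tuple_consS n (z : R * n.-tuple R) i :
  tnth (tuple_cons z) (lift ord0 i) = tnth z.2 i.
Proof. exact: tnthS. Qed.

Lemma lebesgue_box_itv n (a b : R) : a <= b ->
  mu n (box (fun=> [set` `[a, b]])) = ((b - a) ^+ n)%:E.
Proof.
move=> ab; rewrite lebesgue_tuple_box//.
rewrite (eq_bigr (fun=> (b - a)%:E)); last first.
  move=> i _; rewrite lebesgue_measure_itv/= lte_fin.
  case: ifPn => [_|]; first by rewrite -EFinB.
  by rewrite -leNgt => ba; rewrite (@le_anti _ _ a b) ?subrr// ab ba.
by rewrite prodEFin prodr_const card_ord.
Qed.

(** Boxes generate the sigma-algebra, and permuting the factors does not
    change the volume of a box. *)
Lemma pushforward_tuple_perm n (s : {perm 'I_n}) (A : set (n.-tuple R)) :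
  measurable A -> pushforward (mu n) (tuple_perm s) A = mu n A.
Proof.
move=> mA.
pose g k : set (n.-tuple R) := box (fun=> [set` `[- k%:R, k%:R]]).
have lebg k : (mu n (g k) < +oo)%E.
  by rewrite lebesgue_box_itv ?ltry// (@le_trans _ _ 0)// oppr_le0.
have boxs (B : 'I_n -> set R) :
    tuple_perm s @^-1` box B = box (fun i => B (s^-1%g i)).
  apply/seteqP; split => t /= H i.
    by have := H (s^-1%g i); rewrite tnth_mktuple permKV.
  by rewrite tnth_mktuple; have := H (s i); rewrite permK.
have psE (B : 'I_n -> set R) : (forall i, measurable (B i)) ->
    pushforward (mu n) (tuple_perm s) (box B) = mu n (box B).
  move=> mB; rewrite /pushforward boxs !lebesgue_tuple_box//.
  by rewrite [RHS](reindex_inj (@perm_inj _ s^-1%g)).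
have mtp := measurable_tuple_perm s.
pose nu :
  {measure set (n.-tuple R) -> \bar R} := pushforward (mu n) (tuple_perm s).
rewrite -[LHS]/(nu mtp A).
apply: (@measure_unique _ _ _ _ g (measurable_boxE n) _ _ _ (nu mtp) (mu n)) => //.
- move=> _ _ [B mB ->] [C mC ->]; exists (fun i => B i `&` C i).
    by move=> i; exact: measurableI.
  apply/seteqP; split => t /=.
    by move=> [tB tC] i; split; [exact: tB|exact: tC].
  by move=> H; split => i; have [] := H i.
- by move=> k; exists (fun=> [set` `[- k%:R, k%:R]]).
- apply/seteqP; split => // t _.
  exists (Num.truncn (\sum_i `|tnth t i|)).+1 => // i /=.
  rewrite in_itv/= -ler_norml (@le_trans _ _ (\sum_i `|tnth t i|))//.
    by rewrite (bigD1 i)//= lerDl sumr_ge0.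
  exact/ltW/truncnS_gt.
- by move=> _ [B mB ->]; exact: psE.
- by move=> k; rewrite /nu/= psE//; exact: lebg.
Qed.


Lemma ge0_integral_tuple_perm n (s : {perm 'I_n}) (D : set (n.-tuple R))
    (f : n.-tuple R -> R) :
  measurable D -> measurable_fun D f -> (forall t, D t -> 0 <= f t) ->
  (\int[mu n]_(t in tuple_perm s @^-1` D) (f (tuple_perm s t))%:E =
   \int[mu n]_(t in D) (f t)%:E)%E.
Proof.
move=> mD /measurable_EFinP mf f0.
rewrite -(ge0_integral_pushforward (measurable_tuple_perm s) (mu n) mD mf).
  apply: eq_measure_integral => [|mtp A mA _]; first exact: measurable_tuple_perm.
  exact: pushforward_tuple_perm.
by move=> t /set_mem /f0; rewrite lee_fin.
Qed.


(** The measure on (n+1)-tuples is by construction the image of a product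
    measure, so that Tonelli and Fubini transfer with the first coordinate as
    inner variable. *)
Lemma ge0_integral_tuple_cons n (f : n.+1.-tuple R -> R) :
  measurable_fun setT f -> (forall t, 0 <= f t) ->
  (\int[mu n.+1]_t (f t)%:E =
   \int[lebesgue_measure \x mu n]_z (f (tuple_cons z))%:E)%E.
Proof.
move=> /measurable_EFinP mf f0.
have mc := @measurable_tuple_cons R n.
rewrite [LHS](_ : _ = \int[pushforward (lebesgue_measure \x mu n)%E
  (@tuple_cons R n)]_t (f t)%:E)%E// ge0_integral_pushforward//.
by move=> t _; rewrite lee_fin.
Qed.

Lemma lebesgue_tuple_tonelli n (f : n.+1.-tuple R -> R) :
  measurable_fun setT f -> (forall t, 0 <= f t) ->
  (\int[mu n.+1]_t (f t)%:E =
   \int[mu n]_t \int[lebesgue_measure]_x (f (tuple_cons (x, t)))%:E)%E.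
Proof.
move=> mf f0; rewrite ge0_integral_tuple_cons//.
rewrite -(@fubini_tonelli2 _ _ _ _ _ lebesgue_measure (mu n)
  ((EFin \o f) \o @tuple_cons R n))//.
- apply: measurableT_comp; last exact: measurable_tuple_cons.
  exact/measurable_EFinP.
- by move=> t; rewrite lee_fin.
Qed.

Lemma lebesgue_tuple_fubini n (f : n.+1.-tuple R -> R) :
  measurable_fun setT f -> (mu n.+1).-integrable setT (EFin \o f) ->
  (\int[mu n.+1]_t (f t)%:E =
   \int[mu n]_t \int[lebesgue_measure]_x (f (tuple_cons (x, t)))%:E)%E.
Proof.
move=> mf /integrableP[_ intf].
have icf : (lebesgue_measure \x mu n)%E.-integrable setT
    ((EFin \o f) \o @tuple_cons R n).
  apply/integrableP; split.
    apply: measurableT_comp; last exact: measurable_tuple_cons.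
    exact/measurable_EFinP.
  move: intf; rewrite (@ge0_integral_tuple_cons _ (fun t => `|f t|))//.
  exact: measurableT_comp.
transitivity (\int[lebesgue_measure \x mu n]_z (f (tuple_cons z))%:E)%E.
  rewrite integralE [RHS]integralE; congr (_ - _)%E.
    have -> : (fun t => (f t)%:E)^\+%E = EFin \o f^\+ by exact: funerpos.
    rewrite ge0_integral_tuple_cons//; last exact: measurable_funrpos.
    by apply: eq_integral => z _; rewrite -[LHS]/((EFin \o f^\+) _) -funerpos !funeposE.
  have -> : (fun t => (f t)%:E)^\-%E = EFin \o f^\- by exact: funerneg.
  rewrite ge0_integral_tuple_cons//; last exact: measurable_funrneg.
  by apply: eq_integral => z _; rewrite -[LHS]/((EFin \o f^\-) _) -funerneg !funenegE.
by rewrite -(integral21_prod_meas1 icf).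
Qed.

Lemma measurable_fun_lin n (a : 'I_n -> R) (b : R) :
  measurable_fun [set: n.-tuple R] (fun t => \sum_i a i * tnth t i + b).
Proof.
apply: measurable_funD => //; apply: measurable_sum => i.
by apply: measurable_funM => //; exact: measurable_tnth.
Qed.

Lemma measurable_hyperplane n (a : 'I_n -> R) (c : R) :
  measurable [set t : n.-tuple R | \sum_i a i * tnth t i = c].
Proof.
rewrite (_ : [set _ | _] = (fun t => \sum_i a i * tnth t i + 0) @^-1` [set c]).
  by rewrite -[X in measurable X]setTI; exact: measurable_fun_lin.
by apply/seteqP; split => t /=; rewrite addr0.
Qed.

(** The coordinates may be permuted so that the hyperplane is not parallel to
    the first axis; each line in this direction then meets it once. *)
Lemma lebesgue_tuple_hyperplane n (a : 'I_n -> R) (c : R) :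
  (exists i, a i != 0) ->
  mu n [set t | \sum_i a i * tnth t i = c] = 0%E.
Proof.
have mH := measurable_hyperplane.
case: n a => [|n] a [i ai0]; first by case: i ai0.
wlog i0 : a i ai0 / i = ord0.
  move=> hw; pose s : {perm 'I_n.+1} := tperm i ord0.
  have <- := hw (a \o s) ord0; rewrite /= ?tpermR//.
  rewrite -(pushforward_tuple_perm s); last exact: mH.
  rewrite /pushforward; congr (mu _ _); apply/seteqP; split => t /= <-;
    rewrite [RHS](reindex_inj (@perm_inj _ s)); apply: eq_bigr => j _;
    by rewrite /= tnth_mktuple ?tpermK.
subst i.
rewrite -[X in mu _ X]setIT -integral_indic//; last exact: mH.
rewrite lebesgue_tuple_tonelli//; last by apply: measurable_indic; exact: mH.
apply: integral0_eq => t _; apply: (@eq_trans _ _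
  (\int[lebesgue_measure]_x
    (\1_[set (c - \sum_i a (lift ord0 i) * tnth t i) / a ord0] x)%:E)%E).
  apply: eq_integral => x _; rewrite !indicE.
  congr (nat_of_bool _)%:R%:E; apply/idP/idP => /set_mem.
    rewrite /= big_ord_recl tnth_tuple_cons0 => <-; apply/mem_set => /=.
    under eq_bigr do rewrite tnth_tuple_consS.
    by rewrite addrK mulrC mulKf.
  move=> /= ->; apply/mem_set => /=; rewrite big_ord_recl tnth_tuple_cons0.
  under [X in _ + X]eq_bigr do rewrite tnth_tuple_consS.
  by rewrite mulrCA divff// mulr1 subrK.
rewrite integral_indic// setIT; exact: lebesgue_measure_set1.
Qed.

End tuple_measure.

(** * The positive part and its integral over the reference simplex *)

Section positive_part.
Context {R : realType}.

Definition pos_part (x : R) : R := Num.max x 0.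

Definition pos_prim (x : R) : R := pos_part x ^+ 2 / 2.

Lemma continuous_pos : continuous pos_part.
Proof.
move=> x; apply: (@continuous_max _ _ id (cst 0) x); first exact: cvg_id.
exact: cvg_cst.
Qed.

(** The difference quotient differs from [pos_part x] by at most the size of the
    increment, whatever x is, so that the kink at 0 is not a special case. *)
Lemma is_derive_pos_prim (x : R) : is_derive x 1 pos_prim (pos_part x).
Proof.
have bound h : h != 0 ->
    `|pos_part x - h^-1 * (pos_prim (h + x) - pos_prim x)| <= `|h|.
  move=> h0; have nh0 : 0 < `|h| by rewrite normr_gt0.
  rewrite -(ler_pM2l nh0).
  rewrite -normrM mulrBr mulVKf// -expr2 real_normK ?num_real//.
  rewrite ler_norml /pos_prim /pos_part.
  by case: (leP x 0) => x0; case: (leP (h + x) 0) => hx0; apply/andP; split; nra.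
have H : h^-1 *: ((pos_prim \o shift x) (h *: 1) - pos_prim x) @[h --> 0^'] --> pos_part x.
  apply/cvgrPdist_le => e e0; near=> h.
  rewrite /= /shift/= -!/(GRing.scale _ _) [h *: 1]mulr1.
  apply: (le_trans (bound h _)).
    by near: h; exact: nbhs_dnbhs_neq.
  by near: h; exact: dnbhs0_le.
apply: DeriveDef; first by apply/cvg_ex; exists (pos_part x).
exact/cvg_lim.
Unshelve. all: by end_near.
Qed.

Lemma integral_derivative_eq0 (F f : R -> R) (L : R) :
  (forall x : R, is_derive x 1 F (f x)) -> continuous f -> 0 <= L -> F L = F 0 ->
  (\int[lebesgue_measure]_(x in `[0%R, L]) (f x)%:E = 0)%E.
Proof.
move=> dF cf; rewrite le_eqVlt => /predU1P[<- _|L0 FL].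
  by rewrite set_itv1 integral_set1.
rewrite (continuous_FTC2 L0 (F := F)).
- by rewrite FL subee.
- exact: continuous_subspaceT.
- have cF x : {for x, continuous F}.
    by apply/differentiable_continuous/derivable1_diffP; have [] := dF x.
  split; [by move=> x _; have [] := dF x| |].
    by apply: cvg_at_right_filter; exact: cF.
  by apply: cvg_at_left_filter; exact: cF.
- by move=> x _; rewrite derive1E; have [] := dF x.
Qed.
End positive_part.

Section simplex_integral.
Context {R : realType}.
Local Notation mu := (lebesgue_tuple R).

(** Coordinate 0 goes with the vertex at the origin of the reference simplex,
    that is, with the base vertex in the chart of a face. *)
Definition bary n (t : n.-tuple R) (k : 'I_n.+1) : R :=
  if unlift ord0 k is Some j then tnth t j else 1 - \sum_j tnth t j.

Lemma bary0 n (t : n.-tuple R) : bary t ord0 = 1 - \sum_j tnth t j.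
Proof. by rewrite /bary unlift_none. Qed.

Lemma baryS n (t : n.-tuple R) j : bary t (lift ord0 j) = tnth t j.
Proof. by rewrite /bary liftK. Qed.

Lemma sum_bary n (t : n.-tuple R) : \sum_k bary t k = 1.
Proof.
rewrite big_ord_recl bary0.
by under [X in _ + X]eq_bigr do rewrite baryS; rewrite subrK.
Qed.

Lemma bary_ge0 n (t : n.-tuple R) k : ref_simplex t -> 0 <= bary t k.
Proof.
move=> [t0 t1]; case: (unliftP ord0 k) => [j ->|->].
  by rewrite baryS.
by rewrite bary0 subr_ge0.
Qed.

Lemma bary_le1 n (t : n.-tuple R) k : ref_simplex t -> bary t k <= 1.
Proof.
by move=> rt; rewrite -(sum_bary t) (bigD1 k)//= lerDl sumr_ge0// => j _; exact: bary_ge0.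
Qed.

Definition bary_comb n (x : 'I_n.+1 -> R) (t : n.-tuple R) : R :=
  \sum_k bary t k * x k.

Lemma measurable_bary n k : measurable_fun setT (fun t : n.-tuple R => bary t k).
Proof.
have mt (j : 'I_n) : measurable_fun setT (fun t : n.-tuple R => tnth t j).
  exact: measurable_tnth.
rewrite /bary; case: unlift => [j|]//.
by apply: measurable_funB => //; apply: measurable_sum.
Qed.

Lemma measurable_bary_comb n (x : 'I_n.+1 -> R) : measurable_fun setT (bary_comb x).
Proof.
apply: measurable_sum => k; apply: measurable_funM => //.
exact: measurable_bary.
Qed.

Lemma measurable_pos : measurable_fun setT (@pos_part R).
Proof. by apply: measurable_maxr. Qed.

Lemma measurable_pos_comb n (x : 'I_n.+1 -> R) :
  measurable_fun setT (pos_part \o bary_comb x).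
Proof. by apply: measurableT_comp measurable_pos (measurable_bary_comb x). Qed.

Lemma ref_simplexE n :
  @ref_simplex R n = [set t | forall k, 0 <= bary t k].
Proof.
apply/seteqP; split => t /=; first by move=> rt k; exact: bary_ge0.
move=> bt; split => [k|]; first by rewrite -baryS.
by rewrite -subr_ge0 -bary0.
Qed.

Lemma measurable_ref_simplex n : measurable (@ref_simplex R n).
Proof.
rewrite ref_simplexE (_ : [set _ | _] =
    \bigcap_(k in [set: 'I_n.+1]) (fun t => bary t k) @^-1` `[0, +oo[).
  apply: fin_bigcap_measurable => // k _; rewrite -[X in measurable X]setTI.
  exact: measurable_bary.
apply/seteqP; split => t /= bt k; first by move=> _; rewrite /= in_itv/= andbT.
by have := bt k I; rewrite /= in_itv/= andbT.
Qed.

Lemma ref_simplex_lty n : (mu n (@ref_simplex R n) < +oo)%E.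
Proof.
apply: (@le_lt_trans _ _ (mu n (box (fun=> `[0, 1]))))%classic.
  apply: le_measure; rewrite ?inE; [exact: measurable_ref_simplex| |].
    exact: measurable_box.
  move=> t rt j /=; rewrite in_itv/= -baryS.
  by rewrite bary_ge0// bary_le1.
by rewrite lebesgue_box_itv ?ltry.
Qed.

Lemma ref_simplex_gt0 n : (0 < mu n (@ref_simplex R n))%E.
Proof.
apply: (@lt_le_trans _ _ (mu n (box (fun=> `[0, n.+1%:R^-1]))))%classic.
  by rewrite lebesgue_box_itv// subr0 lte_fin exprn_gt0// invr_gt0.
apply: le_measure; rewrite ?inE; [exact: measurable_box|exact: measurable_ref_simplex|].
move=> t bt; split => [k|]; first by have /andP[] := bt k.
apply: (@le_trans _ _ (\sum_(k < n) n.+1%:R^-1)).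
  by apply: ler_sum => k _; have /andP[] := bt k.
rewrite sumr_const card_ord -[_ *+ n]mulr_natr ler_pdivrMl// mulr1 ler_nat.
exact: leqnSn.
Qed.

Lemma pos_ge0 (x : R) : 0 <= pos_part x.
Proof. by rewrite /pos_part le_max lexx orbT. Qed.

Lemma norm_pos (x : R) : `|pos_part x| <= `|x|.
Proof. by rewrite ger0_norm ?pos_ge0// ge_max ler_norm normr_ge0. Qed.

Lemma norm_bary_comb n (x : 'I_n.+1 -> R) t : ref_simplex t ->
  `|bary_comb x t| <= \sum_k `|x k|.
Proof.
move=> rt; apply: (le_trans (ler_norm_sum _ _ _)); apply: ler_sum => k _.
rewrite normrM ger0_norm ?bary_ge0// ler_piMl//; exact: bary_le1.
Qed.

Lemma integrable_bary_comb n (x : 'I_n.+1 -> R) :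
  (mu n).-integrable (@ref_simplex R n) (EFin \o bary_comb x).
Proof.
apply: measurable_bounded_integrable.
- exact: measurable_ref_simplex.
- exact: ref_simplex_lty.
- by apply: measurable_funTS; exact: measurable_bary_comb.
- exists (\sum_k `|x k|); split; first exact: num_real.
  by move=> M xM t rt; apply: (le_trans (norm_bary_comb x rt)); exact: ltW.
Qed.

Lemma integrable_pos_comb n (x : 'I_n.+1 -> R) :
  (mu n).-integrable (@ref_simplex R n) (EFin \o (pos_part \o bary_comb x)).
Proof.
apply: measurable_bounded_integrable.
- exact: measurable_ref_simplex.
- exact: ref_simplex_lty.
- by apply: measurable_funTS; exact: measurable_pos_comb.
- exists (\sum_k `|x k|); split; first exact: num_real.
  move=> M xM t rt; apply: (le_trans (norm_pos _)).
  by apply: (le_trans (norm_bary_comb x rt)); exact: ltW.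
Qed.

(** Barycentric coordinates add up to 1, so that every affine function on a face
    is the combination of its values x at the vertices: up to the surface element
    this is the integral over the face of the positive part of that function. *)
Definition pos_integral n (x : 'I_n.+1 -> R) : R :=
  \int[mu n]_(t in @ref_simplex R n) pos_part (bary_comb x t).

End simplex_integral.

(** * Symmetry of the integral over a simplex *)

Section simplex_symmetry.
Context {R : realType}.
Local Notation mu := (lebesgue_tuple R).

Lemma bary_comb_cons n (x : 'I_n.+2 -> R) s (t : n.-tuple R) :
  bary_comb x (tuple_cons (s, t)) =
  s * (x (lift ord0 ord0) - x ord0) + ((1 - \sum_j tnth t j) * x ord0 +
    \sum_j tnth t j * x (lift ord0 (lift ord0 j))).
Proof.
have bS j : bary (tuple_cons (s, t)) (lift ord0 (lift ord0 j)) = tnth t j.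
  by rewrite baryS tnth_tuple_consS.
rewrite /bary_comb 2!big_ord_recl bary0 baryS big_ord_recl !tnth_tuple_cons0/=.
under [X in 1 - (_ + X)]eq_bigr do rewrite tnth_tuple_consS.
under [X in _ + (_ + X) = _]eq_bigr do rewrite bS.
by rewrite /=; ring.
Qed.

(** The section of the simplex by a line parallel to the first axis is a segment
    starting at 0. *)
Lemma integral_slices0 n (h : n.+1.-tuple R -> R) :
  measurable_fun setT h ->
  (mu n.+1).-integrable (@ref_simplex R n.+1) (EFin \o h) ->
  (forall t : n.-tuple R, 0 <= 1 - \sum_j tnth t j ->
    (\int[lebesgue_measure]_(s in [set` `[0, 1 - \sum_j tnth t j]%R])
      (h (tuple_cons (s, t)))%:E = 0)%E) ->
  \int[mu n.+1]_(t in @ref_simplex R n.+1) h t = 0.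
Proof.
move=> mh ih h0; rewrite Rintegral_mkcond /Rintegral.
have mr := @measurable_ref_simplex R n.+1.
rewrite lebesgue_tuple_fubini; last 2 first.
- by apply/(measurable_restrictT _ mr); exact: measurable_funTS.
- by rewrite -restrict_EFin; apply/(integrable_mkcond _ mr).
rewrite integral0_eq// => t _.
have [[t0 t1]|nt] := pselect (ref_simplex t); last first.
  apply: integral0_eq => s _; rewrite patchE memNset// => -[st0 st1].
  apply: nt; split=> [k|].
    by have := st0 (lift ord0 k); rewrite tnth_tuple_consS.
  apply: le_trans st1; rewrite big_ord_recl.
  under [X in _ <= _ + X]eq_bigr do rewrite tnth_tuple_consS.
  by rewrite lerDr.
rewrite -(h0 t) ?subr_ge0// [RHS]integral_mkcond; apply: eq_integral => s _.
rewrite !patchE; set b1 := (X in if X then _ else _); set b2 := (X in _ = if X then _ else _).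
suff -> : b1 = b2 by case: b2.
apply/idP/idP => /set_mem H; apply/mem_set.
  move: H => [st0 st1]; rewrite /= in_itv/=; have := st0 ord0.
  rewrite tnth_tuple_cons0 => ->/=; rewrite lerBrDr.
  move: st1; rewrite big_ord_recl.
  by under [X in _ + X <= _]eq_bigr do rewrite tnth_tuple_consS.
move: H; rewrite /= in_itv/= => /andP[s0 s1]; split.
  move=> k; case: (unliftP ord0 k) => [j ->|->].
    by rewrite tnth_tuple_consS.
  by rewrite tnth_tuple_cons0.
rewrite big_ord_recl; under [X in _ + X <= _]eq_bigr do rewrite tnth_tuple_consS.
by rewrite /= -lerBrDr.
Qed.

Lemma integrable_scaled_pos_comb n (k : R) (x : 'I_n.+1 -> R) :
  (mu n).-integrable (@ref_simplex R n)
    (EFin \o (fun t => k * pos_part (bary_comb x t))).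
Proof.
exact: (integrableZl (@measurable_ref_simplex R n) k (integrable_pos_comb x)).
Qed.

Lemma integrable_pos_comb3 n (a b c : R) (x y z : 'I_n.+1 -> R) :
  (mu n).-integrable (@ref_simplex R n) (EFin \o (fun t =>
    a * pos_part (bary_comb x t) + b * pos_part (bary_comb y t) +
    c * pos_part (bary_comb z t))).
Proof.
have mr := @measurable_ref_simplex R n.
have ixy := integrableD mr (integrable_scaled_pos_comb a x)
  (integrable_scaled_pos_comb b y).
exact: (integrableD mr ixy (integrable_scaled_pos_comb c z)).
Qed.

Lemma measurable_pos_comb3 n (a b c : R) (x y z : 'I_n.+1 -> R) :
  measurable_fun setT (fun t =>
    a * pos_part (bary_comb x t) + b * pos_part (bary_comb y t) +
    c * pos_part (bary_comb z t)).
Proof.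
have mp k w : measurable_fun setT (fun t => k * pos_part (@bary_comb R n w t)).
  by apply: measurable_funM => //; exact: measurable_pos_comb.
by apply: measurable_funD => //; exact: measurable_funD.
Qed.

Lemma Rintegral_pos_comb3 n (a b c : R) (x y z : 'I_n.+1 -> R) :
  \int[mu n]_(t in @ref_simplex R n) (a * pos_part (bary_comb x t) +
    b * pos_part (bary_comb y t) + c * pos_part (bary_comb z t)) =
  a * pos_integral x + b * pos_integral y + c * pos_integral z.
Proof.
have mr := @measurable_ref_simplex R n.
have iz := @integrable_scaled_pos_comb n.
have ixy := integrableD mr (iz a x) (iz b y).
rewrite RintegralD//.
by rewrite RintegralD// !RintegralZl//; exact: integrable_pos_comb.
Qed.

Lemma is_derive_pos_prim_affine (d u s : R) :
  is_derive s 1 (fun r => pos_prim (r * d + u)) (d * pos_part (s * d + u)).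
Proof.
have dl : is_derive s 1 (fun r => r * d + u) d.
  have -> : (fun r : R => r * d + u) = (d \*o id) + cst u.
    by apply/funext => r; rewrite /= mulrC.
  by apply: is_derive_eq; rewrite addr0 [LHS]mulr1.
rewrite mulrC; exact: (@is_derive1_comp _ pos_prim (fun r => r * d + u) s _ _
  (is_derive_pos_prim (s * d + u)) dl).
Qed.

Lemma continuous_pos_affine (d u : R) : continuous (fun r : R => pos_part (r * d + u)).
Proof.
move=> s; have : (r * d + u) @[r --> s] --> s * d + u.
  by apply: cvgD; [apply: cvgMl; exact: cvg_id|exact: cvg_cst].
by apply: continuous_cvg; exact: continuous_pos.
Qed.


Lemma continuous_scaled_pos_affine (k d u : R) :
  continuous (fun r : R => k * pos_part (r * d + u)).
Proof.
move=> s; apply: cvgM; first exact: cvg_cst.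
exact: continuous_pos_affine.
Qed.

(** This is the recurrence of divided differences: by the Hermite-Genocchi
    formula [pos_integral x] is the divided difference at the nodes x of an
    iterated antiderivative of the positive part. It holds slice by slice. With
    all coordinates but the first held fixed, the integrand over a segment,
    times the difference of the values at the two ends, is the derivative of
    [pos_prim] along the segment, and the boundary terms of the three faces
    cancel. *)
Lemma pos_integral_triple n (x : 'I_n.+3 -> R) (k0 := ord0 : 'I_n.+3)
    (k1 := lift ord0 ord0 : 'I_n.+3) (k2 := lift ord0 (lift ord0 ord0) : 'I_n.+3) :
  (x k2 - x k0) * pos_integral (x \o lift k1) =
  (x k1 - x k0) * pos_integral (x \o lift k2) +
  (x k2 - x k1) * pos_integral (x \o lift k0).
Proof.
apply/eqP; rewrite -subr_eq0 opprD addrA -!mulNr -Rintegral_pos_comb3; apply/eqP.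
apply: integral_slices0.
- exact: measurable_pos_comb3.
- exact: integrable_pos_comb3.
move=> t L0.
have l10 : lift k1 ord0 = k0 by exact: val_inj.
have l11 : lift k1 (lift ord0 ord0) = k2 by exact: val_inj.
have l20 : lift k2 ord0 = k0 by exact: val_inj.
have l21 : lift k2 (lift ord0 ord0) = k1 by exact: val_inj.
have lS k j : k = k1 \/ k = k2 -> lift k (lift ord0 (lift ord0 j)) = lift k0 (lift ord0 (lift ord0 j)).
  by move=> [->|->]; exact: val_inj.
under eq_integral do rewrite !bary_comb_cons/= l10 l11 l20 l21.
pose u := \sum_j tnth t j * x (lift k0 (lift ord0 (lift ord0 j))).
pose L := 1 - \sum_j tnth t j.
have uE k : k = k1 \/ k = k2 ->
    \sum_j tnth t j * x (lift k (lift ord0 (lift ord0 j))) = u.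
  by move=> kk; apply: eq_bigr => j _; rewrite lS.
rewrite (uE _ (or_introl erefl)) (uE _ (or_intror erefl)).
rewrite -/L -/u.
pose g y0 y1 s := s * (y1 - y0) + (L * y0 + u).
pose F s := pos_prim (g (x k0) (x k2) s) - pos_prim (g (x k0) (x k1) s) -
  pos_prim (g (x k1) (x k2) s).
apply: (@integral_derivative_eq0 _ F) => //.
- move=> s; rewrite !mulNr.
  apply: is_deriveB; first apply: is_deriveB; exact: is_derive_pos_prim_affine.
- move=> s; apply: cvgD; last exact: continuous_scaled_pos_affine.
  by apply: cvgD; exact: continuous_scaled_pos_affine.
- have gL y0 y1 : g y0 y1 L = L * y1 + u by rewrite /g; ring.
  have g0 y0 y1 : g y0 y1 0 = L * y0 + u by rewrite /g; ring.
  by rewrite /F !gL !g0; ring.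
Qed.

(** The slice integral times the difference of the two nodes is an increment of
    [pos_prim], which changes sign when the nodes are exchanged. *)
Lemma pos_integral_swap01 n (x : 'I_n.+2 -> R) :
  pos_integral (x \o tperm ord0 (lift ord0 ord0)) = pos_integral x.
Proof.
set y := x \o _; set d := x (lift ord0 ord0) - x ord0.
have [d0|d0] := eqVneq d 0.
  have x10 : x (lift ord0 ord0) = x ord0 by apply/eqP; rewrite -subr_eq0 -/d d0.
  congr pos_integral; apply/funext => k; rewrite /y/=.
  by case: tpermP => [->|->|//]; rewrite x10.
suff : d * pos_integral x + (- d) * pos_integral y + 0 * pos_integral x = 0.
  by rewrite mul0r addr0 mulNr -mulrBr => /eqP; rewrite mulf_eq0 (negPf d0)/= subr_eq0 => /eqP.
rewrite -Rintegral_pos_comb3; apply: integral_slices0.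
- exact: measurable_pos_comb3.
- exact: integrable_pos_comb3.
move=> t L0.
have y0 : y ord0 = x (lift ord0 ord0) by rewrite /y/= tpermL.
have y1 : y (lift ord0 ord0) = x ord0 by rewrite /y/= tpermR.
have yS j : y (lift ord0 (lift ord0 j)) = x (lift ord0 (lift ord0 j)).
  by rewrite /y/= tpermD.
under eq_integral do rewrite mul0r addr0 !bary_comb_cons/= y0 y1.
pose u := \sum_j tnth t j * x (lift ord0 (lift ord0 j)).
have uE : \sum_j tnth t j * y (lift ord0 (lift ord0 j)) = u.
  by apply: eq_bigr => j _; rewrite yS.
rewrite uE -/u; set L := 1 - _.
pose g y0 y1 s := s * (y1 - y0) + (L * y0 + u).
pose F s := pos_prim (g (x ord0) (x (lift ord0 ord0)) s) +
  pos_prim (g (x (lift ord0 ord0)) (x ord0) s).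
apply: (@integral_derivative_eq0 _ F) => //.
- move=> s; rewrite /d opprB.
  by apply: is_deriveD; exact: is_derive_pos_prim_affine.
- by move=> s; apply: cvgD; exact: continuous_scaled_pos_affine.
- have gL y0' y1' : g y0' y1' L = L * y1' + u by rewrite /g; ring.
  have g0 y0' y1' : g y0' y1' 0 = L * y0' + u by rewrite /g; ring.
  by rewrite /F !gL !g0; ring.
Qed.

Lemma bary_tuple_perm n (s : {perm 'I_n}) (t : n.-tuple R) k :
  bary (tuple_perm s t) k = bary t (lift_perm ord0 ord0 s k).
Proof.
case: (unliftP ord0 k) => [j ->|->].
  by rewrite lift_perm_lift !baryS tnth_mktuple.
rewrite lift_perm_id !bary0 [in RHS](reindex_inj (@perm_inj _ s)).
by congr (_ - _); apply: eq_bigr => j _; rewrite tnth_mktuple.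
Qed.

Lemma pos_integral_lift_perm n (s : {perm 'I_n}) (x : 'I_n.+1 -> R) :
  pos_integral (x \o lift_perm ord0 ord0 s) = pos_integral x.
Proof.
have combE t : bary_comb (x \o lift_perm ord0 ord0 s) (tuple_perm s t) =
    bary_comb x t.
  rewrite /bary_comb [RHS](reindex_inj (@perm_inj _ (lift_perm ord0 ord0 s))).
  by apply: eq_bigr => k _; rewrite bary_tuple_perm.
have rE : tuple_perm s @^-1` @ref_simplex R n = @ref_simplex R n.
  rewrite ref_simplexE; apply/seteqP; split => t /= rt k.
    by rewrite -(permKV (lift_perm ord0 ord0 s) k) -bary_tuple_perm.
  by rewrite bary_tuple_perm.
rewrite /pos_integral /Rintegral; congr fine.
rewrite -(ge0_integral_tuple_perm s (f := pos_part \o bary_comb _)).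
- by rewrite rE; apply: eq_integral => t _; rewrite /= combE.
- exact: measurable_ref_simplex.
- by apply: measurable_funTS; exact: measurable_pos_comb.
- by move=> t _; exact: pos_ge0.
Qed.

(** Permutations that fix 0 permute the coordinates of the reference simplex;
    together with the exchange of 0 and 1 they generate all permutations. *)
Lemma pos_integral_perm n (s : {perm 'I_n.+1}) (x : 'I_n.+1 -> R) :
  pos_integral (x \o s) = pos_integral x.
Proof.
case: n s x => [|n] s x.
  by congr pos_integral; apply/funext => k; rewrite /= [s k]ord1 [k]ord1.
pose inv (r : {perm 'I_n.+2}) := forall y : 'I_n.+2 -> R, pos_integral (y \o r) = pos_integral y.
have invM r1 r2 : inv r1 -> inv r2 -> inv (r1 * r2)%g.
  move=> i1 i2 y; rewrite -[RHS]i2 -[RHS]i1; congr pos_integral.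
  by apply/funext => k; rewrite /= permM.
have invL (i j : 'I_n.+1) : inv (tperm (lift ord0 i) (lift ord0 j)).
  have -> : tperm (lift ord0 i) (lift ord0 j) = lift_perm ord0 ord0 (tperm i j).
    apply/permP => k; case: (unliftP ord0 k) => [k' ->|->].
      rewrite lift_perm_lift.
      by apply/esym/(inj_tperm _ _ _ (@lift_inj _ ord0)).
    by rewrite lift_perm_id tpermD.
  by move=> y; exact: pos_integral_lift_perm.
have inv0 (j : 'I_n.+1) : inv (tperm ord0 (lift ord0 j)).
  (* conjugation carries the exchange of 0 and 1 to that of 0 and j + 1 *)
  pose z := tperm (lift ord0 (ord0 : 'I_n.+1)) (lift ord0 j).
  have -> : tperm ord0 (lift ord0 j) = (tperm ord0 (lift ord0 ord0) ^ z)%g.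
    by rewrite tpermJ /z tpermL tpermD.
  rewrite conjgE tpermV; apply: (invM); first exact: invL.
  by apply: (invM); [move=> y; exact: pos_integral_swap01|exact: invL].
suff : inv s by apply.
have [ts -> _] := prod_tpermP s.
elim: ts => [|[i j] ts IH].
  by rewrite big_nil => y; congr pos_integral; apply/funext => k; rewrite /= perm1.
rewrite big_cons; apply: (invM) => //=.
case: (unliftP ord0 i) => [i' ->|->]; case: (unliftP ord0 j) => [j' ->|->] //.
- by rewrite tpermC.
- by rewrite tperm1 => y; congr pos_integral; apply/funext => k; rewrite /= perm1.
Qed.
End simplex_symmetry.

(** * The kink integrated over the faces of a simplex *)

Section face_moments.
Context {R : realType}.
Local Notation mu := (lebesgue_tuple R).

(** Every barycentric coordinate has this integral, by symmetry; see
    [Rintegral_bary]. *)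
Definition bary_moment n : R := \int[mu n]_(t in @ref_simplex R n) bary t ord0.

Lemma Rintegral_bary n (k : 'I_n.+1) :
  \int[mu n]_(t in @ref_simplex R n) bary t k = bary_moment n.
Proof.
(* coordinates are nonnegative on the simplex: the positive part of the
   combination with unit weights is the coordinate itself *)
have bE j : \int[mu n]_(t in @ref_simplex R n) bary t j =
    pos_integral (fun i => (i == j)%:R).
  apply: eq_Rintegral => t /set_mem rt.
  rewrite /bary_comb (bigD1 j)//= eqxx mulr1 big1 ?addr0.
    by rewrite /pos_part max_l// bary_ge0.
  by move=> i /negPf ->; rewrite mulr0.
rewrite /bary_moment !bE -[RHS](pos_integral_perm (tperm ord0 k)).
congr pos_integral; apply/funext => i /=.
by rewrite -[X in _ = (_ == X)%:R](tpermR ord0 k) (inj_eq (@perm_inj _ _)).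
Qed.

Lemma integrable_bary n (k : 'I_n.+1) :
  (mu n).-integrable (@ref_simplex R n) (EFin \o (fun t => bary t k)).
Proof.
apply: eq_integrable (integrable_bary_comb (fun i => (i == k)%:R)).
  exact: measurable_ref_simplex.
move=> t _; rewrite /= /bary_comb (bigD1 k)//= eqxx mulr1 big1 ?addr0//.
by move=> i /negPf ->; rewrite mulr0.
Qed.

Lemma Rintegral_bary_comb n (x : 'I_n.+1 -> R) :
  \int[mu n]_(t in @ref_simplex R n) bary_comb x t = bary_moment n * \sum_k x k.
Proof.
have mr := @measurable_ref_simplex R n.
have ib k := integrableZr mr (x k) (integrable_bary k).
rewrite /Rintegral (@eq_integral _ _ _ _ _
  (fun t => \sum_k (bary t k * x k)%:E)%E); last first.
  by move=> t _; rewrite sumEFin.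
rewrite integral_sum//.
rewrite (eq_bigr (fun k => (bary_moment n * x k)%:E)).
  by rewrite sumEFin/= mulr_sumr.
move=> k _; rewrite -(Rintegral_bary k) -RintegralZr//; last exact: integrable_bary.
by rewrite fineK//; exact: integrable_fin_num (ib k).
Qed.

(** The coordinates have equal integrals and add up to 1. *)
Lemma bary_momentE n : bary_moment n * n.+1%:R =
  \int[mu n]_(t in @ref_simplex R n) 1.
Proof.
have := Rintegral_bary_comb (fun=> 1 : R) (n := n).
rewrite sumr_const card_ord => <-.
by apply: eq_Rintegral => t _; rewrite /bary_comb; under eq_bigr do rewrite mulr1; rewrite sum_bary.
Qed.

Lemma bary_moment_gt0 n : 0 < bary_moment n.
Proof.
rewrite -(pmulr_lgt0 _ (ltr0Sn R n)) bary_momentE.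
rewrite Rintegral_cst; last exact: measurable_ref_simplex.
by rewrite mul1r fine_gt0// ref_simplex_gt0 ref_simplex_lty.
Qed.

(** The positive part is nondecreasing and 1-Lipschitz, and the node x k enters
    with the weight [bary t k]. *)
Lemma pos_integral_le n (x y : 'I_n.+1 -> R) k :
  y k <= x k -> (forall j, j != k -> y j = x j) ->
  pos_integral y <= pos_integral x <= pos_integral y + (x k - y k) * bary_moment n.
Proof.
move=> yx yxE; have mr := @measurable_ref_simplex R n.
have cE t : bary_comb x t = bary_comb y t + (x k - y k) * bary t k.
  rewrite /bary_comb (bigD1 k)//= [in RHS](bigD1 k)//=.
  by under [in RHS]eq_bigr => j jk do rewrite yxE//; ring.
apply/andP; split.
  apply: le_Rintegral => //; [exact: integrable_pos_comb..|].
  move=> t rt; rewrite /pos_part cE.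
  have := bary_ge0 k rt; set b := bary t k => b0.
  have : 0 <= (x k - y k) * b by rewrite mulr_ge0// subr_ge0.
  by move=> ?; rewrite ge_max !le_max lexx lerDl orbT; apply/andP; split => //; apply/orP; left.
have ib : (mu n).-integrable (@ref_simplex R n) (EFin \o (fun t => (x k - y k) * bary t k)).
  exact: (integrableZl mr (x k - y k) (integrable_bary k)).
have iy := integrable_pos_comb y.
rewrite -(Rintegral_bary k) -RintegralZl//; last exact: integrable_bary.
rewrite /pos_integral -RintegralD//.
apply: le_Rintegral => //; [exact: integrable_pos_comb|exact: (integrableD mr iy ib)|].
move=> t rt; rewrite /pos_part cE.
have := bary_ge0 k rt; set b := bary t k => b0.
have : 0 <= (x k - y k) * b by rewrite mulr_ge0// subr_ge0.
move: (_ * b) => e e0; rewrite ge_max; apply/andP; split.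
  by rewrite lerD2r le_max lexx.
by rewrite addr_ge0// le_max lexx orbT.
Qed.

(** By this lemma [pos_integral_triple] extends to any three nodes. *)
Lemma exists_perm3 n (i j k : 'I_n.+3) : i != j -> i != k -> j != k ->
  exists s : {perm 'I_n.+3}, [/\ s ord0 = i, s (lift ord0 ord0) = j &
    s (lift ord0 (lift ord0 ord0)) = k].
Proof.
move=> ij ik jk.
pose k0 := ord0 : 'I_n.+3; pose k1 := lift ord0 ord0 : 'I_n.+3.
pose k2 := lift ord0 (lift ord0 ord0) : 'I_n.+3.
pose t1 := tperm k0 i; pose t2 := tperm k1 (t1 j); pose t3 := tperm k2 (t2 (t1 k)).
have t1i : t1 i = k0 by rewrite /t1 tpermR.
have t1j : t1 j != k0 by rewrite -t1i (inj_eq (@perm_inj _ _)) eq_sym.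
have t20 : t2 k0 = k0 by rewrite /t2 tpermD// eq_sym.
have t2j : t2 (t1 j) = k1 by rewrite /t2 tpermR.
have t30 : t3 k0 = k0.
  rewrite /t3 tpermD//.
  by rewrite -t20 -t1i !(inj_eq (@perm_inj _ _)) eq_sym.
have t31 : t3 k1 = k1.
  rewrite /t3 tpermD//.
  by rewrite -t2j !(inj_eq (@perm_inj _ _)) eq_sym.
exists (t3 * t2 * t1)%g; rewrite !permM; split.
- by rewrite -/k0 t30 t20 /t1 tpermL.
- by rewrite -/k1 t31 /t2 tpermL /t1 tpermK.
- by rewrite /t3 tpermL /t2 tpermK /t1 tpermK.
Qed.

(** On both sides the nodes are those of x but x (s j), in different orders. *)
Lemma pos_integral_face n (s : {perm 'I_n.+2}) (x : 'I_n.+2 -> R) j :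
  pos_integral (x \o s \o lift j) = pos_integral (x \o lift (s j)).
Proof.
have ne k : s j != s (lift j k) by rewrite (inj_eq (@perm_inj _ _)) neq_lift.
pose r k := odflt k (unlift (s j) (s (lift j k))).
have rE k : lift (s j) (r k) = s (lift j k).
  by rewrite /r; have [k' ->] := unlift_some (ne k); rewrite liftK.
have rinj : injective r.
  by move=> k k' /(congr1 (lift (s j))); rewrite !rE => /perm_inj/lift_inj.
rewrite -[RHS](pos_integral_perm (perm rinj)); congr pos_integral.
by apply/funext => k; rewrite /= permE rE.
Qed.

Lemma pos_integral_collinear n (d : 'I_n.+3 -> R) i j k :
  (d k - d i) * pos_integral (d \o lift j) =
  (d j - d i) * pos_integral (d \o lift k) +
  (d k - d j) * pos_integral (d \o lift i).
Proof.
have [->|ij] := eqVneq i j; first by ring.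
have [->|ik] := eqVneq i k; first by ring.
have [->|jk] := eqVneq j k; first by ring.
have [s [<- <- <-]] := exists_perm3 ij ik jk.
by rewrite -!pos_integral_face; exact: pos_integral_triple (d \o s).
Qed.

(** The two faces have all vertices in common but one. *)
Lemma pos_integral_face_slope n (d : 'I_n.+3 -> R) i j : d j <= d i ->
  pos_integral (d \o lift i) <= pos_integral (d \o lift j) <=
    pos_integral (d \o lift i) + (d i - d j) * bary_moment n.+1.
Proof.
have [->|ij] := eqVneq i j; first by move=> _; rewrite subrr mul0r addr0 lexx.
pose k1 := lift ord0 ord0 : 'I_n.+3.
have [s [s0 s1]] : exists s : {perm 'I_n.+3}, s ord0 = i /\ s k1 = j.
  pose t := tperm ord0 i.
  have tj : t j != ord0.
    by rewrite -[X in _ != X](tpermR ord0 i) (inj_eq (@perm_inj _ _)) eq_sym.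
  exists (tperm k1 (t j) * t)%g; rewrite !permM.
  split; last by rewrite tpermL tpermK.
  by rewrite (@tpermD _ k1 (t j)) /t ?tpermL.
rewrite -s0 -s1 -!pos_integral_face => dji.
have l10 : lift k1 ord0 = ord0 by exact: val_inj.
have e0 : (d \o s \o lift ord0) ord0 = d (s k1) by [].
have e1 : (d \o s \o lift k1) ord0 = d (s ord0) by rewrite /= l10.
rewrite -e0 -e1; apply: pos_integral_le; first by rewrite e0 e1.
move=> k; case: (unliftP ord0 k) => [k' -> _|->]; last by rewrite eqxx.
by rewrite /=; congr (d (s _)); exact: val_inj.
Qed.

(** The points (d j, m_j), where m_j is the integral over the face opposite to
    the node j, lie on a line by [pos_integral_collinear], and
    [pos_integral_face_slope] bounds its slope. By the divergence theorem theta is,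
    for non-constant d, the fraction of the simplex on which d is positive. *)
Lemma pos_integral_face_affine n (d : 'I_n.+3 -> R) :
  exists C theta : R, 0 <= theta <= 1 /\
    forall j, pos_integral (d \o lift j) = C - theta * bary_moment n.+1 * d j.
Proof.
pose m j := pos_integral (d \o lift j).
have bm0 := bary_moment_gt0 n.+1.
have [[[i j]]/= dij|dE] := pselect (exists ij : 'I_n.+3 * 'I_n.+3, d ij.2 < d ij.1); last first.
  exists (m ord0), 0; split; first by rewrite lexx ler01.
  have dd i j : d i = d j.
    by apply/le_anti; rewrite !leNgt; apply/andP; split; apply/negP => ?;
      apply: dE; [exists (i, j)|exists (j, i)].
  move=> j; rewrite mul0r mul0r subr0 /m; congr pos_integral.
  by apply/funext => k /=; exact: dd.
have dij0 : 0 < d i - d j by rewrite subr_gt0.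
have /andP[mij mji] := pos_integral_face_slope (ltW dij).
pose sl := (m j - m i) / (d i - d j).
have slE : sl * (d i - d j) = m j - m i by rewrite divfK// gt_eqF.
exists (m i + sl * d i), (sl / bary_moment n.+1); split.
  rewrite divr_ge0 ?(ltW bm0)//=; last by rewrite divr_ge0 ?(ltW dij0)// subr_ge0.
  by rewrite ler_pdivrMr// mul1r ler_pdivrMr// lerBlDl mulrC.
move=> k; rewrite divfK ?gt_eqF//; have := pos_integral_collinear d i j k.
rewrite -/(m i) -/(m j) -/(m k) => H.
apply: (@mulfI _ (d i - d j)); first by rewrite gt_eqF.
nra.
Qed.

End face_moments.

(** * Barycentric coordinates *)

Section geometry.
Context {R : realType} (n : nat).
Local Notation N := n.+1.
Local Notation vec := 'cV[R]_N.
Implicit Types (u v x y : vec) (p : 'I_N.+1 -> vec).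

Lemma dotE u v : dot u v = \sum_i u i 0 * v i 0.
Proof. by rewrite /dot mxE; apply: eq_bigr => i _; rewrite mxE. Qed.

Lemma dotC u v : dot u v = dot v u.
Proof. by rewrite !dotE; apply: eq_bigr => i _; rewrite mulrC. Qed.

Lemma dotDr u v w : dot u (v + w) = dot u v + dot u w.
Proof. by rewrite /dot mulmxDr mxE. Qed.

Lemma dotZr u k v : dot u (k *: v) = k * dot u v.
Proof. by rewrite /dot -scalemxAr mxE. Qed.

Lemma dotDl u v w : dot (v + w) u = dot v u + dot w u.
Proof. by rewrite dotC dotDr !(dotC u). Qed.

Lemma dotZl u k v : dot (k *: v) u = k * dot v u.
Proof. by rewrite dotC dotZr dotC. Qed.

Lemma dotNr u v : dot u (- v) = - dot u v.
Proof. by rewrite -scaleN1r dotZr mulN1r. Qed.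

Lemma dotNl u v : dot (- v) u = - dot v u.
Proof. by rewrite -scaleN1r dotZl mulN1r. Qed.

Lemma dot0r u : dot u 0 = 0.
Proof. by rewrite -(scale0r 0) dotZr mul0r. Qed.

Lemma dot_sumr I (r : seq I) (P : pred I) u (F : I -> vec) :
  dot u (\sum_(i <- r | P i) F i) = \sum_(i <- r | P i) dot u (F i).
Proof.
by apply: (big_morph (dot u)) => [v w|]; rewrite ?dotDr ?dot0r.
Qed.

Lemma dot_ge0 u : 0 <= dot u u.
Proof. by rewrite dotE sumr_ge0// => i _; rewrite -expr2 sqr_ge0. Qed.

Lemma dot_eq0 u : dot u u = 0 -> u = 0.
Proof.
rewrite dotE => /eqP; rewrite psumr_eq0; last by move=> i _; rewrite -expr2 sqr_ge0.
move=> /allP u0; apply/colP => i; rewrite mxE.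
by have := u0 i (mem_index_enum _); rewrite /= mulf_eq0 orbb => /eqP.
Qed.

Lemma continuous_dot u : continuous (dot u).
Proof.
move=> x; rewrite (_ : dot u = fun y : vec => \sum_i u i 0 * y i 0); last first.
  by apply/funext => y; rewrite dotE.
apply: (@continuous_big R _ +%R 0 xpredT (@add_continuous R)) x => i _ x.
have c1 : {for x, continuous (fun _ : vec => u i 0)} by exact: cst_continuous.
have c2 : {for x, continuous (fun y : vec => y i 0)} by exact: coord_continuous.
exact: (continuousM c1 c2).
Qed.

(** Row k holds homogeneous coordinates of the vertex p k, so that [bcoord]
    solves for the weights of a point and for their sum at the same time. *)
Definition bary_matrix p : 'M[R]_(1 + N) :=
  row_mx (const_mx 1 : 'M[R]_(1 + N, 1)) (\matrix_(k, r) p k r 0).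

Definition bcoord p x (k : 'I_N.+1) : R :=
  (row_mx (1%:M : 'M[R]_1) x^T *m invmx (bary_matrix p) : 'rV[R]_(1 + N)) 0 k.

Lemma mul_bary_matrix p (l : 'rV[R]_(1 + N)) :
  l *m bary_matrix p = row_mx (\sum_k l 0 k)%:M (\sum_k l 0 k *: p k)^T.
Proof.
rewrite /bary_matrix (mul_mx_row l); congr row_mx; apply/rowP => j; rewrite !mxE.
  by rewrite [j]ord1 eqxx mulr1n; apply: eq_bigr => k _; rewrite mxE mulr1.
by rewrite summxE; apply: eq_bigr => k _; rewrite !mxE.
Qed.

Lemma bary_matrix_unit p : affinely_independent p -> bary_matrix p \in unitmx.
Proof.
move=> hp; rewrite -row_free_unit; apply: inj_row_free => l.
rewrite mul_bary_matrix -[RHS]row_mx0 => /eq_row_mx[l1 lp].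
apply/rowP => k; rewrite mxE; apply: hp.
  by move/matrixP : l1 => /(_ 0 0); rewrite !mxE eqxx mulr1n.
by move/(congr1 trmx) : lp; rewrite trmxK trmx0.
Qed.

Lemma bcoord_sum p x : affinely_independent p ->
  \sum_k bcoord p x k = 1 /\ \sum_k bcoord p x k *: p k = x.
Proof.
move=> /bary_matrix_unit Qu.
have := mulmxKV Qu (row_mx (1%:M : 'M[R]_1) x^T : 'rV[R]_(1 + N)).
rewrite mul_bary_matrix => /eq_row_mx[l1 lp]; split.
  by move/matrixP : l1 => /(_ 0 0); rewrite !mxE eqxx !mulr1n.
by move/(congr1 trmx) : lp; rewrite !trmxK.
Qed.

Lemma bcoord_uniq p x l : affinely_independent p ->
  \sum_k l k = 1 -> \sum_k l k *: p k = x -> forall k, bcoord p x k = l k.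
Proof.
move=> hp l1 lx k; have [b1 bx] := bcoord_sum x hp.
apply/eqP; rewrite -subr_eq0; apply/eqP.
apply: (hp (fun k => bcoord p x k - l k)).
  by rewrite sumrB b1 l1 subrr.
by under eq_bigr do rewrite scalerBl; rewrite sumrB bx lx subrr.
Qed.

Definition bcoord_grad p k : vec := \col_r invmx (bary_matrix p) (rshift 1 r) k.
Definition bcoord_const p k : R := invmx (bary_matrix p) (lshift N ord0) k.

Lemma bcoord_affine p x k : bcoord p x k = dot (bcoord_grad p k) x + bcoord_const p k.
Proof.
rewrite /bcoord mxE (big_split_ord _ (m := 1) (n := N))/= big_ord1 addrC; congr (_ + _).
  by rewrite dotE; apply: eq_bigr => r _; rewrite row_mxEr !mxE mulrC.
by rewrite row_mxEl mxE eqxx mulr1n mul1r.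
Qed.

Lemma open_simplexE p : affinely_independent p ->
  elem p = [set x | forall k, 0 < bcoord p x k].
Proof.
move=> hp; apply/seteqP; split => x /=.
  by move=> [l [l0 l1 ->]] k; rewrite (bcoord_uniq hp l1 erefl).
move=> bx; have [b1 bxx] := bcoord_sum x hp.
by exists (bcoord p x); split.
Qed.

Lemma continuous_affine u (b : R) : continuous (fun x : vec => dot u x + b).
Proof.
move=> x; have c1 : {for x, continuous (fun _ : vec => b)} by exact: cst_continuous.
exact: (continuousD (@continuous_dot u x) c1).
Qed.

Lemma open_elem p : affinely_independent p -> open (elem p).
Proof.
move=> hp; rewrite open_simplexE//.
rewrite openE => x /= bx; rewrite /interior.
apply: (@filter_forall _ _ (fun k y => 0 < bcoord p y k) (nbhs x) _) => k.
have cb : {for x, continuous (bcoord p ^~ k)}.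
  rewrite (_ : bcoord p ^~ k = fun y => dot (bcoord_grad p k) y + bcoord_const p k).
    exact: continuous_affine.
  by apply/funext => y; exact: bcoord_affine.
exact: (cvgr_gt (bcoord p x k) cb).
Qed.

Lemma affine_comb u (b : R) I (r : seq I) (l : I -> R) (q : I -> vec) :
  \sum_(i <- r) l i = 1 ->
  dot u (\sum_(i <- r) l i *: q i) + b = \sum_(i <- r) l i * (dot u (q i) + b).
Proof.
move=> l1; rewrite dot_sumr; under [RHS]eq_bigr do rewrite mulrDr.
rewrite big_split/= -mulr_suml l1 mul1r; congr (_ + _).
by apply: eq_bigr => i _; rewrite dotZr.
Qed.

Lemma affine_eq0 p u (b : R) : affinely_independent p ->
  (forall k, dot u (p k) + b = 0) -> u = 0 /\ b = 0.
Proof.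
move=> hp up0; have f0 x : dot u x + b = 0.
  have [b1 <-] := bcoord_sum x hp.
  by rewrite affine_comb// big1// => k _; rewrite up0 mulr0.
have b0 : b = 0 by have := f0 0; rewrite dot0r add0r.
by split=> //; apply: dot_eq0; have := f0 u; rewrite b0 addr0.
Qed.

Lemma affine_interpolation p (v : 'I_N.+1 -> R) : affinely_independent p ->
  exists u b, forall k, dot u (p k) + b = v k.
Proof.
move=> hp; exists (\sum_k v k *: bcoord_grad p k), (\sum_k v k * bcoord_const p k).
move=> j; rewrite dotC dot_sumr -big_split/=.
rewrite (bigD1 j)//= dotZr -mulrDr dotC -bcoord_affine.
have bE k : bcoord p (p j) k = (k == j)%:R.
  apply: (bcoord_uniq (l := fun k => (k == j)%:R)) => //.
    by rewrite (bigD1 j)//= eqxx big1 ?addr0// => i /negPf ->.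
  by rewrite (bigD1 j)//= eqxx scale1r big1 ?addr0// => i /negPf ->; rewrite scale0r.
rewrite bE eqxx mulr1 big1 ?addr0// => k kj.
by rewrite dotZr -mulrDr dotC -bcoord_affine bE (negPf kj) mulr0.
Qed.
End geometry.

(** * Limits from inside the element *)

Section limits.
Context {R : realType} (n : nat).
Local Notation N := n.+1.
Local Notation vec := 'cV[R]_N.
Implicit Types (u v x y z : vec) (p : 'I_N.+1 -> vec) (A : set vec).

Lemma near_segment x v A : nbhs x A -> \forall e \near (0 : R)^'+, A (x + e *: v).
Proof.
move=> xA.
have cf : {for (0 : R), continuous (fun e : R => x + e *: v)}.
  have c1 : {for (0 : R), continuous (fun _ : R => x)} by exact: cst_continuous.
  have c2 : {for (0 : R), continuous (fun e : R => e *: v)}.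
    exact: scalel_continuous.
  exact: (continuousD c1 c2).
apply: cvg_within; apply: (cf A); rewrite scale0r addr0; exact: xA.
Qed.

(** The points of a segment ending at x come arbitrarily near to x. *)
Lemma proper_within A x z :
  (forall e : R, 0 < e < 1 -> A ((1 - e) *: x + e *: z)) ->
  ProperFilter (within A (nbhs x)).
Proof.
move=> Ae; apply: Build_ProperFilter_ex => P xP.
have nP : \forall e \near (0 : R)^'+, A (x + e *: (z - x)) -> P (x + e *: (z - x)).
  exact: (@near_segment x (z - x) [set y | A y -> P y] xP).
have [e [e0 e1 eP]] : exists e : R, [/\ 0 < e, e < 1 & A (x + e *: (z - x)) -> P (x + e *: (z - x))].
  near ((0 : R)^'+) => e; exists e; split.
  - by near: e; exact: nbhs_right_gt.
  - by near: e; exact: nbhs_right_lt.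
  - by near: e.
exists (x + e *: (z - x)); apply: eP.
have -> : x + e *: (z - x) = (1 - e) *: x + e *: z.
  by rewrite scalerBr scalerBl scale1r addrA addrAC.
by apply: Ae; rewrite e0.
Unshelve. all: by end_near.
Qed.

Lemma lim_within_eq A x (f g : vec -> R) : ProperFilter (within A (nbhs x)) ->
  {for x, continuous g} -> (forall y, A y -> f y = g y) ->
  lim (f y @[y --> within A (nbhs x)]) = g x.
Proof.
move=> pA cg fg; apply/cvg_lim => // B gB.
have : nbhs x (g @^-1` B) by exact: cg.
by apply: filterS => y By Ay; rewrite /= fg.
Qed.

Lemma grad_affine A x (f : vec -> R) u (b : R) : open A -> A x ->
  (forall y, A y -> f y = dot u y + b) -> grad f x = u.
Proof.
move=> oA Ax fE; apply/colP => i; rewrite mxE.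
have xA : nbhs x A by exact: open_nbhs_nbhs.
rewrite (@near_eq_derive _ _ _ _ (fun y => dot u y + b)); last first.
  by apply: filterS xA => y; exact: fE.
rewrite /derive.
have -> : (fun h : R => h^-1 *: (((fun y => dot u y + b) \o shift x)
    (h *: delta_mx i 0) - (dot u x + b))) = (fun h => h^-1 * (h * u i 0)).
  apply/funext => h; rewrite /= dotDr dotZr.
  have -> : dot u (delta_mx i 0) = u i 0.
    rewrite dotE (bigD1 i)//= mxE !eqxx mulr1 big1 ?addr0// => j /negPf ji.
    by rewrite mxE ji mulr0.
  by rewrite /GRing.scale/=; congr (_ * _); ring.
apply/cvg_lim => //; apply: cvg_near_cst.
near=> h; rewrite mulKf//; near: h; exact: nbhs_dnbhs_neq.
Unshelve. all: by end_near.
Qed.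

Definition closed_simplex p : set vec :=
  [set x | exists l : 'I_N.+1 -> R,
    [/\ forall i, 0 <= l i, \sum_i l i = 1 & x = \sum_i l i *: p i]].

Lemma elem_segment p x z (e : R) : closed_simplex p x -> elem p z -> 0 < e < 1 ->
  elem p ((1 - e) *: x + e *: z).
Proof.
move=> [l [l0 l1 ->]] [m [m0 m1 ->]] /andP[e0 e1].
exists (fun i => (1 - e) * l i + e * m i); split.
- by move=> i; rewrite ltr_wpDl ?mulr_gt0// mulr_ge0// subr_ge0 ltW.
- rewrite big_split/= -!mulr_sumr l1 m1. ring.
- rewrite !scaler_sumr -big_split/=; apply: eq_bigr => i _.
  by rewrite !scalerA -scalerDl.
Qed.

Lemma elem_closed p x : elem p x -> closed_simplex p x.
Proof. by move=> [l [l0 l1 ->]]; exists l; split => // i; exact: ltW. Qed.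

Lemma face_closed p j x : face p j x -> closed_simplex p x.
Proof. by move=> [l [l0 _ l1 ->]]; exists l. Qed.

(** Reversing the normal exchanges the two pieces; results on [elem_pos] thus
    carry over to [elem_neg]. *)
Lemma elem_negE p nh (c : R) : elem_neg p nh c = elem_pos p (- nh) (- c).
Proof.
by apply/seteqP; split => x [? /= xc]; split => //=; move: xc; rewrite dotNl ltrN2.
Qed.

Lemma interfaceN p nh (c : R) : interface p nh c = interface p (- nh) (- c).
Proof.
apply/seteqP; split => x [? /= xc]; split => //=; first by rewrite dotNl xc.
by apply: oppr_inj; rewrite -dotNl.
Qed.

Lemma elem_pos_neq0 p nh (c : R) : affinely_independent p -> dot nh nh = 1 ->
  interface p nh c !=set0 -> elem_pos p nh c !=set0.
Proof.
move=> hp nn [x [px xc]].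
have /(near_segment nh) pn : nbhs x (elem p).
  by apply: open_nbhs_nbhs; split => //; exact: open_elem.
near (0 : R)^'+ => e; exists (x + e *: nh); split.
  by near: e.
rewrite /= dotDr dotZr nn mulr1 xc ltrDl; near: e; exact: nbhs_right_gt.
Unshelve. all: by end_near.
Qed.

Lemma proper_elem_pos p nh (c : R) x : elem_pos p nh c !=set0 ->
  closed_simplex p x -> c <= dot nh x -> ProperFilter (within (elem_pos p nh c) (nbhs x)).
Proof.
move=> [z [pz /= cz]] px cx; apply: (@proper_within _ _ z) => e e01; split.
  exact: elem_segment.
rewrite /= dotDr !dotZr; move: e01 => /andP[e0 e1]; nra.
Qed.

Lemma open_halfspace u (c : R) : open [set x : vec | c < dot u x].
Proof.
rewrite openE => x /= cx; exact: (cvgr_gt (dot u x) (@continuous_dot _ _ u x)).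
Qed.

Lemma open_elem_pos p nh (c : R) : affinely_independent p -> open (elem_pos p nh c).
Proof. by move=> hp; apply: openI; [exact: open_elem|exact: open_halfspace]. Qed.

End limits.

(** * Square integrability and null sets *)

Section integrability.
Context {R : realType} (n : nat).
Local Notation N := n.+1.
Local Notation vec := 'cV[R]_N.
Local Notation mu := (lebesgue_tuple R).
Implicit Types (u v x y z : vec) (p : 'I_N.+1 -> vec) (A : set vec).

Lemma dot_point_of_tuple u t : dot u (point_of_tuple t) = \sum_i u i 0 * tnth t i.
Proof. by rewrite dotE; apply: eq_bigr => i _; rewrite mxE. Qed.

Lemma measurable_affine u (b : R) :
  measurable_fun setT (fun t : N.-tuple R => dot u (point_of_tuple t) + b).
Proof.
rewrite (_ : (fun _ => _) = fun t : N.-tuple R => \sum_i u i 0 * tnth t i + b).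
  exact: measurable_fun_lin.
by apply/funext => t; rewrite dot_point_of_tuple.
Qed.

Lemma measurable_elem p : affinely_independent p ->
  measurable (@point_of_tuple R n @^-1` elem p).
Proof.
move=> hp; rewrite open_simplexE//.
rewrite (_ : _ @^-1` _ = \bigcap_(k in [set: 'I_N.+1])
   (fun t => dot (bcoord_grad p k) (point_of_tuple t) + bcoord_const p k) @^-1` `]0, +oo[).
  apply: fin_bigcap_measurable => // k _; rewrite -[X in measurable X]setTI.
  exact: measurable_affine.
apply/seteqP; split => t /= H k; last by have := H k I; rewrite bcoord_affine/= in_itv/= andbT.
by move=> _; have := H k; rewrite bcoord_affine/= in_itv/= andbT.
Qed.

Lemma elem_bounded p : exists2 K : R, 0 <= K & forall x, elem p x -> forall i, `|x i 0| <= K.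
Proof.
exists (\sum_k \sum_i `|p k i 0|); first by rewrite sumr_ge0// => k _; rewrite sumr_ge0.
move=> x [l [l0 l1 ->]] i; rewrite summxE (le_trans (ler_norm_sum _ _ _))//.
apply: ler_sum => k _; rewrite mxE normrM ger0_norm ?(ltW (l0 k))//.
apply: (@le_trans _ _ `|p k i 0|).
  rewrite ler_piMl// -l1 (bigD1 k)//= lerDl sumr_ge0// => j _; exact: ltW.
by rewrite (bigD1 i)//= lerDl sumr_ge0.
Qed.

Lemma affine_bounded p u (b : R) : exists K : R, forall x, elem p x -> `|dot u x + b| <= K.
Proof.
have [K K0 xK] := elem_bounded p.
exists (\sum_i `|u i 0| * K + `|b|) => x px.
rewrite (le_trans (ler_normD _ _))// lerD2r dotE (le_trans (ler_norm_sum _ _ _))//.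
by apply: ler_sum => i _; rewrite normrM ler_wpM2l// xK.
Qed.

(** An element is bounded, hence of finite measure. *)
Lemma bounded_L2_on p (f : vec -> R) (K : R) : affinely_independent p ->
  measurable_fun setT (f \o @point_of_tuple R n) ->
  (forall x, elem p x -> `|f x| <= K) -> L2_on (elem p) f.
Proof.
move=> hp mf fK; rewrite /L2_on.
pose D := @point_of_tuple R n @^-1` elem p.
have mD : measurable D by exact: measurable_elem.
have Dfin : (mu N D < +oo)%E.
  have [k k0 xk] := elem_bounded p.
  apply: (@le_lt_trans _ _ (mu N (box (fun=> [set` `[- k, k]])))).
    apply: le_measure; rewrite ?inE//; first exact: measurable_box.
    move=> t Dt i; rewrite /= in_itv/= -ler_norml.
    by have := xk _ Dt i; rewrite mxE.
  by rewrite lebesgue_box_itv ?ltry// (@le_trans _ _ 0)// oppr_le0.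
have fE : (f \_ (elem p)) \o @point_of_tuple R n = (f \o @point_of_tuple R n) \_ D.
  by apply/funext => t; rewrite /= !patchE.
rewrite fE.
have mg : measurable_fun setT ((f \o @point_of_tuple R n) \_ D).
  by apply/(measurable_restrictT _ mD); exact: measurable_funTS.
rewrite inE; apply/andP; split; first by rewrite inE.
rewrite inE /= /finite_norm unlock poweR_lty//.
pose h t := `|f (point_of_tuple t)| ^+ 2.
have ih : (mu N).-integrable D (EFin \o h).
  apply: measurable_bounded_integrable => //.
    by apply/measurable_funX/measurable_funTS; exact: measurableT_comp.
  exists (K ^+ 2); split; first exact: num_real.
  move=> M KM t Dt; apply: le_trans (ltW KM).
  by rewrite ger0_norm ?exprn_ge0// lerXn2r ?nnegrE// ?(le_trans _ (fK _ Dt))// fK.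
have -> : (\int[mu N]_t `|(EFin \o (f \o @point_of_tuple R n) \_ D) t| `^ 2 =
    \int[mu N]_(t in D) (h t)%:E)%E.
  rewrite [RHS]integral_mkcond; apply: eq_integral => t _.
  rewrite /= !patchE; case: ifP => _.
    by rewrite powR_mulrn.
  by rewrite normr0 powR0.
by have := integrable_fin_num mD ih; rewrite fin_numElt => /andP[].
Qed.

Lemma ae_eq_on_off_interface p nh (c : R) (f g : vec -> R) :
  dot nh nh = 1 ->
  (forall x, elem p x -> dot nh x != c -> f x = g x) ->
  ae_eq_on (elem p) f g.
Proof.
move=> nn fg.
pose H : set (N.-tuple R) := [set t | \sum_i nh i 0 * tnth t i = c].
exists H; split; first exact: measurable_hyperplane.
  apply: lebesgue_tuple_hyperplane; apply: contrapT => /forallNP nh0.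
  move: nn; rewrite dotE big1 => [/eqP|i _]; first by rewrite eq_sym oner_eq0.
  by have /negP := nh0 i; rewrite negbK => /eqP ->; rewrite mul0r.
move=> t /= ft; apply: contrapT => Ht; apply: ft => pt.
by apply: fg => //; apply/eqP; rewrite dot_point_of_tuple.
Qed.
End integrability.

(** * The immersed space *)

Section ife.
Context {R : realType} (n : nat).
Local Notation N := n.+1.
Local Notation vec := 'cV[R]_N.
Local Notation mu := (lebesgue_tuple R).
Implicit Types (u v x y z : vec).
Variables (p : 'I_N.+1 -> vec) (nh : vec) (c : R).
Hypotheses (hp : affinely_independent p) (hnh : dot nh nh = 1).
Hypothesis hcut : interface p nh c !=set0.

(** A continuous function that is affine on either side of the hyperplane is
    affine up to a multiple of the positive part of the signed distance to it. *)
Definition ife_fun u (b al : R) x : R := dot u x + b + al * pos_part (dot nh x - c).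

Lemma ife_fun_ge u b al x : c <= dot nh x ->
  ife_fun u b al x = dot (u + al *: nh) x + (b - al * c).
Proof.
move=> cx; rewrite /ife_fun /pos_part max_l ?subr_ge0// dotDl dotZl; ring.
Qed.

Lemma ife_fun_le u b al x : dot nh x <= c -> ife_fun u b al x = dot u x + b.
Proof. by move=> cx; rewrite /ife_fun /pos_part max_r ?subr_le0// mulr0 addr0. Qed.

Lemma continuous_ife_fun u b al : continuous (ife_fun u b al).
Proof.
move=> x; have c1 := @continuous_affine R n u b x.
have c2 : {for x, continuous (fun y => pos_part (dot nh y - c))}.
  apply: (@continuous_comp _ _ _ (fun y => dot nh y - c) pos_part).
    exact: continuous_affine.
  exact: continuous_pos.
have c3 : {for x, continuous (fun _ : vec => al)} by exact: cst_continuous.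
exact: (continuousD c1 (continuousM c3 c2)).
Qed.

Let pos0 : elem_pos p nh c !=set0 := elem_pos_neq0 hp hnh hcut.

Let hnhN : dot (- nh) (- nh) = 1.
Proof. by rewrite dotNl dotNr opprK. Qed.

Let hcutN : interface p (- nh) (- c) !=set0.
Proof. by rewrite -interfaceN. Qed.

Let neg0 : elem_pos p (- nh) (- c) !=set0 := elem_pos_neq0 hp hnhN hcutN.

Lemma proper_elem_neg x : closed_simplex p x -> dot nh x <= c ->
  ProperFilter (within (elem_neg p nh c) (nbhs x)).
Proof.
move=> px xc; rewrite elem_negE; apply: (proper_elem_pos neg0 px).
by rewrite dotNl lerN2.
Qed.

Lemma proper_elem_cut x : closed_simplex p x ->
  ProperFilter (within (elem_pos p nh c `|` elem_neg p nh c) (nbhs x)).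
Proof.
move=> px.
have sub A B : A `<=` B -> ProperFilter (within A (nbhs x)) ->
    ProperFilter (within B (nbhs x)).
  move=> AB pA; apply: Build_ProperFilter_ex => P PB.
  have PA : nbhs x [set y | A y -> P y].
    have : nbhs x [set y | B y -> P y] by exact: PB.
    by apply: filterS => y By Ay; exact/By/AB.
  exact: (@filter_ex _ (within A (nbhs x)) _ P PA).
have [cx|cx] := leP c (dot nh x).
  by apply: (sub _ _ _ (proper_elem_pos pos0 px cx)); exact: subsetUl.
by apply: (sub _ _ _ (proper_elem_neg px (ltW cx))); exact: subsetUr.
Qed.

Lemma trace_eq (f g : vec -> R) x : closed_simplex p x -> continuous g ->
  (forall y, (elem_pos p nh c `|` elem_neg p nh c) y -> f y = g y) ->
  trace p nh c f x = g x.
Proof.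
move=> px cg fg; apply: lim_within_eq fg; last exact: cg.
exact: proper_elem_cut.
Qed.

Lemma jump_eq (f g h : vec -> R) x : interface p nh c x ->
  continuous g -> continuous h ->
  (forall y, elem_pos p nh c y -> f y = g y) ->
  (forall y, elem_neg p nh c y -> f y = h y) ->
  jump p nh c f x = g x - h x.
Proof.
move=> [/elem_closed px /= xc] cg ch fg fh; rewrite /jump; congr (_ - _).
  apply: lim_within_eq fg; last exact: cg.
  by apply: proper_elem_pos => //; rewrite xc.
apply: lim_within_eq fh; last exact: ch.
by apply: proper_elem_neg => //; rewrite xc.
Qed.

Section flux.
Variables Bp Bm : 'M[R]_N.

Lemma jump_flux (f : vec -> R) u1 u2 (b1 b2 : R) x : interface p nh c x ->
  (forall y, elem_pos p nh c y -> f y = dot u1 y + b1) ->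
  (forall y, elem_neg p nh c y -> f y = dot u2 y + b2) ->
  jump p nh c (fun y => dot (piecewise_mx p nh c Bp Bm y *m grad f y) nh) x =
  dot (Bp *m u1) nh - dot (Bm *m u2) nh.
Proof.
move=> ix f1 f2.
apply: (jump_eq (g := fun=> dot (Bp *m u1) nh) (h := fun=> dot (Bm *m u2) nh) ix).
- exact: cst_continuous.
- exact: cst_continuous.
- move=> y yp; rewrite /piecewise_mx mem_set//.
  by rewrite (grad_affine (open_elem_pos hp) yp f1).
- move=> y yn; rewrite /piecewise_mx memNset; last first.
    by move=> [_ /= cy]; case: yn => _ /= yc; have := lt_trans cy yc; rewrite ltxx.
  move: (yn) f2; rewrite elem_negE => yn' f2.
  by rewrite (grad_affine (open_elem_pos hp) yn' f2).
Qed.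

Lemma ife_fun_in u b al : dot (Bp *m (u + al *: nh)) nh = dot (Bm *m u) nh ->
  ife_space p nh c Bp Bm (ife_fun u b al).
Proof.
move=> flux.
have fp y : elem_pos p nh c y -> ife_fun u b al y = dot (u + al *: nh) y + (b - al * c).
  by move=> [_ /= /ltW]; exact: ife_fun_ge.
have fm y : elem_neg p nh c y -> ife_fun u b al y = dot u y + b.
  by move=> [_ /= /ltW]; exact: ife_fun_le.
split.
- have [K1 hK1] := affine_bounded p u b; have [K2 hK2] := affine_bounded p nh (- c).
  apply: (@bounded_L2_on _ _ _ _ (K1 + `|al| * K2)) => //.
    apply: measurable_funD; first exact: measurable_affine.
    apply: measurable_funM => //; apply: measurableT_comp (measurable_affine _ _).
    exact: measurable_pos.
  move=> x px; rewrite (le_trans (ler_normD _ _))// lerD ?hK1// normrM.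
  by rewrite ler_wpM2l// (le_trans (norm_pos _))// hK2.
- by exists (u + al *: nh), (b - al * c).
- by exists u, b.
- move=> x ix; rewrite (jump_eq (g := ife_fun u b al) (h := ife_fun u b al) ix) ?subrr//;
  exact: continuous_ife_fun.
- by move=> x ix; rewrite (jump_flux ix fp fm) flux subrr.
Qed.

(** The two affine pieces agree on a relatively open part of the hyperplane, so
    their gradients differ by a multiple of the normal. *)
Lemma ife_spaceP f : ife_space p nh c Bp Bm f -> exists u b al,
  dot (Bp *m (u + al *: nh)) nh = dot (Bm *m u) nh /\
  forall x, elem p x -> dot nh x != c -> f x = ife_fun u b al x.
Proof.
move=> [_ [u1 [b1 f1]] [u2 [b2 f2]] jf jg].
have [x0 ix0] := hcut; have [px0 /= cx0] := ix0.
pose w := u1 - u2; pose al := dot w nh.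
have agree x : interface p nh c x -> dot w x + (b1 - b2) = 0.
  move=> ix; rewrite -[RHS](jf x ix) (jump_eq (g := fun y => dot u1 y + b1)
    (h := fun y => dot u2 y + b2) ix)//; try exact: continuous_affine.
  by rewrite /w dotDl dotNl; ring.
have wE : w = al *: nh.
  apply/eqP; rewrite -subr_eq0; apply/eqP/dot_eq0.
  set tau := w - _.
  have tn : dot tau nh = 0 by rewrite /tau dotDl dotNl dotZl hnh mulr1 subrr.
  have : nbhs x0 (elem p) by apply: open_nbhs_nbhs; split => //; exact: open_elem.
  move=> /(near_segment tau) pe.
  have [e [e0 ee]] : exists e : R, 0 < e /\ elem p (x0 + e *: tau).
    near ((0 : R)^'+) => e; exists e; split; last by near: e.
    by near: e; exact: nbhs_right_gt.
  have ie : interface p nh c (x0 + e *: tau).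
    by split => //=; rewrite dotDr dotZr (dotC nh tau) tn mulr0 addr0.
  have := agree _ ie; have := agree _ ix0.
  rewrite dotDr dotZr addrAC => -> /eqP; rewrite add0r mulf_eq0 gt_eqF//= => /eqP wt.
  by rewrite {1}/tau dotDl dotNl dotZl (dotC nh tau) tn mulr0 subr0.
have u1E : u1 = u2 + al *: nh by rewrite -wE /w addrC subrK.
have b1E : b1 = b2 - al * c.
  have := agree _ ix0; rewrite wE dotZl cx0; lra.
exists u2, b2, al; split.
  have := jg _ ix0; rewrite (jump_flux ix0 f1 f2) u1E.
  by move=> /eqP; rewrite subr_eq0 => /eqP.
move=> x px; rewrite neq_lt => /orP[xc|xc].
  by rewrite f2// ife_fun_le// ltW.
by rewrite f1// ife_fun_ge ?ltW// -u1E -b1E.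
Unshelve. all: by end_near.
Qed.
End flux.
End ife.

(** * Mean values on the faces *)

Section face_means.
Context {R : realType} (n : nat).
Local Notation N := n.+1.
Local Notation vec := 'cV[R]_N.
Local Notation mu := (lebesgue_tuple R).
Implicit Types (u v x y z : vec).
Variables (p : 'I_N.+1 -> vec) (nh : vec) (c : R).
Hypotheses (hp : affinely_independent p) (hnh : dot nh nh = 1).
Hypothesis hcut : interface p nh c !=set0.

Lemma face_edges_inj j (l : 'cV[R]_n) : face_edges p j *m l = 0 -> l = 0.
Proof.
move=> El; apply/colP => k; rewrite [RHS]mxE.
have [u [b ub]] := affine_interpolation
  (fun i => (i == lift j (lift ord0 k))%:R : R) hp.
have ue k' : dot u (col k' (face_edges p j)) = (k' == k)%:R.
  have -> : col k' (face_edges p j) = p (lift j (lift ord0 k')) - p (lift j ord0).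
    by apply/colP => r; rewrite !mxE.
  have := ub (lift j (lift ord0 k')); have := ub (lift j ord0).
  rewrite !(inj_eq (@lift_inj _ _)) (_ : ord0 == lift ord0 k = false)// => u0 u1.
  by rewrite dotDr dotNr -[RHS]u1 -[RHS]subr0 -[X in _ = _ - X]u0; ring.
have : dot u (face_edges p j *m l) = 0 by rewrite El dot0r.
have -> : face_edges p j *m l = \sum_k' l k' 0 *: col k' (face_edges p j).
  by apply/colP => r; rewrite mxE summxE; apply: eq_bigr => k' _; rewrite !mxE mulrC.
rewrite dot_sumr (bigD1 k)//= dotZr ue eqxx mulr1 big1 ?addr0// => k' /negPf kk.
by rewrite dotZr ue kk mulr0.
Qed.

(** Completing the edges by a vector orthogonal to the face gives a square
    matrix whose Gram determinant is the square of its determinant. *)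
Lemma gram_det_gt0 m (E : 'M[R]_(m.+1, m)) :
  (forall l : 'cV[R]_m, E *m l = 0 -> l = 0) -> 0 < \det (E^T *m E).
Proof.
move=> Einj.
have [v vE v0] : exists2 v : 'rV[R]_m.+1, v *m E = 0 & v != 0.
  have : kermx E != 0.
    rewrite kermx_eq0 /row_free; apply/negP => /eqP rE.
    by have := rank_leq_col E; rewrite rE ltnn.
  by move=> /rowV0Pn[v /sub_kermxP vE v0]; exists v.
pose A : 'M[R]_(1 + m) := row_mx v^T E.
have EvT : E^T *m v^T = 0 by rewrite -trmx_mul vE trmx0.
have AA : A^T *m A = block_mx (v *m v^T) 0 0 (E^T *m E).
  by rewrite /A (tr_row_mx v^T E) trmxK (mul_col_row v E^T v^T E) vE EvT.
have vv : 0 < (v *m v^T) 0 0.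
  have := dot_ge0 v^T; rewrite /dot trmxK le_eqVlt => /predU1P[vv|//].
  by move: v0; rewrite -trmx_eq0 (@dot_eq0 _ _ v^T) ?eqxx// /dot trmxK.
have detAA : \det A ^+ 2 = (v *m v^T) 0 0 * \det (E^T *m E).
  by rewrite expr2 -{1}det_tr -det_mulmx AA det_ublock det_mx11.
have : 0 < \det A ^+ 2.
  rewrite exprn_even_gt0//= -unitfE -unitmxE -row_free_unit.
  rewrite row_free_unit -unitmx_tr -row_free_unit; apply: inj_row_free => l.
  rewrite -(hsubmxK l) /A (tr_row_mx v^T E) trmxK (mul_row_col _ _ v E^T) => H.
  have l1 : lsubmx l = 0.
    have := congr1 (mulmx^~ v^T) H; rewrite mulmxDl -!mulmxA EvT mulmx0 addr0 mul0mx.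
    rewrite (mx11_scalar (v *m v^T)) mul_mx_scalar => /eqP.
    by rewrite scaler_eq0 gt_eqF//= => /eqP.
  have l2 : rsubmx l = 0.
    move: H; rewrite l1 mul0mx add0r => /(congr1 trmx).
    by rewrite trmx_mul trmxK trmx0 => /Einj/(congr1 trmx); rewrite trmxK trmx0.
  by rewrite l1 l2 row_mx0.
by rewrite detAA pmulr_rgt0.
Qed.

Lemma face_density_gt0 j : 0 < face_density p j.
Proof. by rewrite sqrtr_gt0; apply: gram_det_gt0 => l; exact: face_edges_inj. Qed.

Lemma face_chartE j t : face_chart p j t = \sum_k bary t k *: p (lift j k).
Proof.
rewrite big_ord_recl bary0; apply/colP => r; rewrite !mxE summxE mulrBl mul1r -addrA.
congr (_ + _); rewrite mulr_suml addrC -sumrB; apply: eq_bigr => k _.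
by rewrite !mxE baryS mulrBl; congr (_ - _); rewrite mulrC.
Qed.

(** In the chart of the face an affine function is the barycentric combination
    of its values at the vertices, and the surface element cancels. *)
Lemma face_mean_ife_fun j (f : vec -> R) u b al :
  (forall x, elem p x -> dot nh x != c -> f x = ife_fun nh c u b al x) ->
  face_mean p nh c j f =
  (bary_moment n * \sum_k (dot u (p (lift j k)) + b) +
   al * pos_integral (fun k => dot nh (p (lift j k)) - c)) /
  (bary_moment n * N%:R).
Proof.
move=> fE; rewrite /face_mean.
have mr := @measurable_ref_simplex R n.
set dn := face_density p j.
have dn0 : dn != 0 by rewrite gt_eqF// face_density_gt0.
have -> : face_integral p j (cst 1) = bary_moment n * N%:R * dn.
  rewrite /face_integral bary_momentE -RintegralZr//.
  have := integrable_bary_comb (fun=> 1 : R) (n := n).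
  apply: eq_integrable => // t _.
  by rewrite /= /bary_comb; under eq_bigr do rewrite mulr1; rewrite sum_bary.
pose x k := dot u (p (lift j k)) + b; pose y k := dot nh (p (lift j k)) - c.
have -> : face_integral p j (trace p nh c f) =
    (bary_moment n * \sum_k x k + al * pos_integral y) * dn.
  have ix := integrable_bary_comb x.
  have iy := integrable_scaled_pos_comb al y.
  rewrite -Rintegral_bary_comb -RintegralZl//; last exact: integrable_pos_comb.
  rewrite -RintegralD// -RintegralZr//; last exact: (integrableD mr ix iy).
  apply: eq_Rintegral => t /set_mem rt; congr (_ * _).
  rewrite (@trace_eq _ _ p nh c hp hnh hcut f (ife_fun nh c u b al)).
  - rewrite /ife_fun face_chartE.
    rewrite !(@affine_comb R n _ _ _ (index_enum _)); last 2 first.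
    + exact: sum_bary.
    + exact: sum_bary.
    by [].
  - apply: (@face_closed _ _ _ j); rewrite -face_chart_image; by exists t.
  - exact: continuous_ife_fun.
  - by move=> z [|] [pz /= zc]; apply: fE => //; rewrite neq_lt zc ?orbT.
by rewrite invfM mulrACA mulfV// mulr1.
Qed.

End face_means.

(** * Unisolvence *)

Section unisolvence.
Context {R : realType}.

(** The values at the vertices of the affine function whose mean values on the
    faces are those of the i-th basis function. *)
Lemma nodal_valuesP n (g : 'I_n.+2 -> R) i :
  (forall j, (\sum_k g k - g j) / n.+1%:R = (i == j)%:R) <->
  (forall j, g j = 1 - n.+1%:R * (i == j)%:R).
Proof.
have N0 : n.+1%:R != 0 :> R by rewrite pnatr_eq0.
have sd : \sum_j (i == j)%:R = 1 :> R.
  by rewrite (bigD1 i)//= eqxx big1 ?addr0// => j; rewrite eq_sym => /negPf ->.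
split=> [gE j|gE j].
  have gE' k : \sum_k g k - g k = n.+1%:R * (i == k)%:R.
    by rewrite -gE mulrC divfK.
  suff G1 : \sum_k g k = 1 by rewrite -gE' G1 subKr.
  have : \sum_j (\sum_k g k - g j) = \sum_j n.+1%:R * (i == j)%:R.
    by apply: eq_bigr => k _; rewrite gE'.
  rewrite sumrB sumr_const card_ord -mulr_sumr sd mulr1 mulrS addrAC subrr add0r.
  by move=> S1; apply: (mulIf N0); rewrite mul1r mulr_natr.
have -> : \sum_k g k = 1.
  under eq_bigr do rewrite gE.
  rewrite sumrB -mulr_sumr sd mulr1 sumr_const card_ord mulrS; ring.
by rewrite gE subKr mulrC mulKf.
Qed.

(** For N >= 2 the affine function with the same mean values on the faces as the
    kink (dot nh x - c)^+ has gradient theta nh with theta in the unit interval: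
    it is normal to the interface whatever the position of the cut. *)
Lemma face_mean_interpolant n (p : 'I_n.+3 -> 'cV[R]_n.+2) nh (c : R) :
  affinely_independent p -> dot nh nh = 1 -> interface p nh c !=set0 ->
  exists theta K : R, 0 <= theta <= 1 /\ forall f u b al,
    (forall x, elem p x -> dot nh x != c -> f x = ife_fun nh c u b al x) ->
    forall j, let g k := dot (u + (al * theta) *: nh) (p k) + (b + al * K) in
      face_mean p nh c j f = (\sum_k g k - g j) / n.+2%:R.
Proof.
move=> hp hnh hcut.
have [C [th [th01 thE]]] := pos_integral_face_affine (fun k => dot nh (p k) - c).
have bm0 := bary_moment_gt0 (R := R) n.+1.
have N0 : n.+2%:R != 0 :> R by rewrite pnatr_eq0.
pose D := \sum_k dot nh (p k).
exists th, ((C / bary_moment n.+1 - th * (D - c)) / n.+2%:R).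
split=> // f u b al fE j g.
rewrite (face_mean_ife_fun hp hnh hcut j fE).
have := thE j; rewrite /comp => ->.
pose K := (C / bary_moment n.+1 - th * (D - c)) / n.+2%:R.
have KE : n.+2%:R * K = C / bary_moment n.+1 - th * (D - c).
  by rewrite -[RHS](divfK N0) [LHS]mulrC.
pose S := \sum_k dot u (p k).
have sl : \sum_k (dot u (p (lift j k)) + b) = S - dot u (p j) + n.+2%:R * b.
  rewrite big_split/= sumr_const card_ord -[b *+ _]mulr_natl; congr (_ + _).
  by rewrite /S (bigD1_ord j)//= addrAC subrr add0r.
have sg : \sum_k g k - g j = S + al * th * D - dot u (p j) - al * th * dot nh (p j) +
    n.+2%:R * (b + al * K).
  rewrite /g -/K; under eq_bigr do rewrite dotDl dotZl.
  rewrite !big_split/= -mulr_sumr !sumr_const !card_ord -!mulrnDl -/S -/D.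
  rewrite -[_ *+ n.+3]mulr_natl mulrS dotDl dotZl; ring.
have bK : n.+2%:R * (b + al * K) =
    n.+2%:R * b + al * (C / bary_moment n.+1 - th * (D - c)).
  by rewrite mulrDr mulrCA KE.
rewrite sl sg bK.
have bmN : bary_moment n.+1 != 0 :> R by rewrite gt_eqF.
clear -N0 bmN; move: (n.+2%:R : R) (bary_moment n.+1) N0 bmN => M B M0 B0.
by field; rewrite M0 B0.
Qed.
End unisolvence.

Theorem mainTheorem5 (R : realType) (n : nat) (hN : n.+1 = 2%N \/ n.+1 = 3%N)
  (p : 'I_n.+2 -> 'cV[R]_n.+1) (hp : affinely_independent p)
  (nh : 'cV[R]_n.+1) (c : R) (hnh : dot nh nh = 1)
  (hcut : interface p nh c !=set0)
  (Bp Bm : 'M[R]_n.+1) (bmp bMp bmm bMm : R)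
  (hbp : 0 < bmp <= bMp) (hbm : 0 < bmm <= bMm)
  (hBp : forall y : 'cV[R]_n.+1, dot y y = 1 -> bmp <= dot y (Bp *m y) <= bMp)
  (hBm : forall y : 'cV[R]_n.+1, dot y y = 1 -> bmm <= dot y (Bm *m y) <= bMm)
  (i : 'I_n.+2) :
  exists phi : 'cV[R]_n.+1 -> R,
    [/\ ife_space p nh c Bp Bm phi,
        forall j : 'I_n.+2, face_mean p nh c j phi = (i == j)%:R &
        forall psi : 'cV[R]_n.+1 -> R,
          ife_space p nh c Bp Bm psi ->
          (forall j : 'I_n.+2, face_mean p nh c j psi = (i == j)%:R) ->
          ae_eq_on (elem p) psi phi].
Proof.
case: n hN p hp nh hnh hcut Bp Bm hBp hBm i => [[]//|n _] p hp nh hnh hcut Bp Bm hBp hBm i.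
have [th [K [/andP[th0 th1] meanE]]] := face_mean_interpolant hp hnh hcut.
pose qp := dot (Bp *m nh) nh; pose qm := dot (Bm *m nh) nh.
have qp0 : 0 < qp.
  have /andP[le _] := hBp nh hnh; have /andP[b0 _] := hbp.
  by rewrite /qp dotC (lt_le_trans b0).
have qm0 : 0 < qm.
  have /andP[le _] := hBm nh hnh; have /andP[b0 _] := hbm.
  by rewrite /qm dotC (lt_le_trans b0).
(* a convex combination of positive numbers *)
pose den := (1 - th) * qp + th * qm.
have den0 : den != 0.
  rewrite gt_eqF// /den; case: (leP th (2^-1)) => th2.
    by rewrite ltr_pwDl ?mulr_gt0 ?mulr_ge0 ?(ltW qm0)//; lra.
  by rewrite ltr_wpDl ?mulr_gt0 ?mulr_ge0 ?(ltW qp0)//; lra.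
(* Once the mean values on the faces have fixed the gradient w of the
   interpolant, the flux condition is a linear equation for al. *)
have fluxE u al (w := u + (al * th) *: nh) :
    dot (Bp *m (u + al *: nh)) nh = dot (Bm *m u) nh <->
    al * den = dot (Bm *m w) nh - dot (Bp *m w) nh.
  rewrite /w !mulmxDr -!scalemxAr !dotDl !dotZl -/qp -/qm /den.
  by split; lra.
have [w [b wE]] := affine_interpolation (fun j => 1 - n.+2%:R * (i == j)%:R : R) hp.
pose al := (dot (Bm *m w) nh - dot (Bp *m w) nh) / den.
pose u := w - (al * th) *: nh.
have uw : u + (al * th) *: nh = w by rewrite subrK.
exists (ife_fun nh c u (b - al * K) al); split.
- by apply: ife_fun_in => //; apply/fluxE; rewrite uw /al divfK.
- move=> j; rewrite (meanE _ u (b - al * K) al)// uw subrK.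
  by move: j; apply/nodal_valuesP.
move=> psi /(ife_spaceP hp hnh hcut)[u' [b' [al' [flux psiE]]]] psim.
have wE' : forall j, dot (u' + (al' * th) *: nh) (p j) + (b' + al' * K) =
    1 - n.+2%:R * (i == j)%:R.
  by apply/nodal_valuesP => j; rewrite -psim (meanE _ u' b' al' psiE).
have [ww bb] : u' + (al' * th) *: nh = w /\ b' + al' * K = b.
  have [] := affine_eq0 (u := u' + (al' * th) *: nh - w)
    (b := b' + al' * K - b) hp.
    by move=> k; rewrite dotDl dotNl addrACA -opprD wE wE' subrr.
  by move=> /eqP; rewrite subr_eq0 => /eqP -> /eqP; rewrite subr_eq0 => /eqP.
have alE : al' = al.
  by apply: (mulIf den0); rewrite /al divfK// -ww; apply/fluxE.
apply: (ae_eq_on_off_interface (c := c) hnh) => x px xc.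
have uE : u' = u by apply: (addIr ((al' * th) *: nh)); rewrite ww alE uw.
have bE : b' = b - al * K by apply: (addIr (al' * K)); rewrite bb alE subrK.
by rewrite psiE// uE bE alE.
Qed.
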